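(* Let $R$ be a commutative ring and let $M$ be an $R$-module. The following statements are equivalent: (1) $M$ is a flat Mittag-Leffler module. (2) $\mathcal M$ is equal to the direct limit of its $\mathcal R$-submodule affine schemes. (3) $\mathcal M=\varinjlim_i\mathcal N_i^*$ for some direct system in which the morphism $\mathcal N_i^*\to\mathcal N_j^*$ is a monomorphism for any $i\le j$; that is, $\mathcal M$ is equal to the direct limit of its reflexive $\mathcal R$-submodule affine schemes. (4) For every $R$-module $N$, the kernel of any morphism $\mathcal N^*\to\mathcal M$ of $\mathcal R$-modules is a reflexive $\mathcal R$-module affine scheme. (5) For every $n$, the kernel of any morphism $\mathcal R^n\to\mathcal M$ of $\mathcal R$-modules is a reflexive $\mathcal R$-module affine scheme. (6) For every $R$-module $N$, any morphism $\mathcal N^*\to\mathcal M$ of $\mathcal R$-modules factors through an $\mathcal R$-submodule scheme of $\mathcal M$ of the form $\mathcal W^*$, for some $R$-module $W$. (7) For every $n$, any morphism $\mathcal R^n\to\mathcal M$ of $\mathcal R$-modules factors through an $\mathcal R$-submodule scheme of $\mathcal M$ of the form $\mathcal W^*$, for some $R$-module $W$.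
   Context: An $R$-module $M$ is a flat Mittag-Leffler module if it is the direct limit of a direct system of free $R$-modules of finite rank $\{L_i\}$ such that the inverse system $\{L_i^*\}$, $L_i^*=\mathrm{Hom}_R(L_i,R)$, satisfies the usual Mittag-Leffler condition: for each $i$ there exists $j\ge i$ such that $\mathrm{Im}(L_k^*\to L_i^* )=\mathrm{Im}(L_j^*\to L_i^* )$ for all $k\ge j$. All functors are covariant functors on the category of commutative $R$-algebras. $\mathcal R$ is the functor of rings $\mathcal R(R'):=R'$. An $\mathcal R$-module $\mathbb M$ is a functor of abelian groups with a morphism of functors $\mathcal R\times\mathbb M\to\mathbb M$ making each $\mathbb M(R')$ an $R'$-module; a morphism of $\mathcal R$-modules is a natural transformation that is $R'$-linear for every $R'$. Kernels and direct limits (over upward directed sets) are those of the category of $\mathcal R$-modules and are computed pointwise. For an $R$-module $M$ (resp. $N$, $W$, etc.), $\mathcal M$ (resp. $\mathcal N$, $\mathcal W$, etc.) denotes the $\mathcal R$-module $\mathcal M(R'):=M\otimes_RR'$. The dual of an $\mathcal R$-module is $\mathbb M^*(R'):=\mathrm{Hom}_{\mathcal R'}(\mathbb M_{|R'},\mathcal R')$, where $\mathbb M_{|R'}$ is the restriction of $\mathbb M$ to commutative $R'$-algebras and $\mathcal R'=\mathcal R_{|R'}$; in particular $\mathcal N^*(R')=\mathrm{Hom}_R(N,R')$. $\mathbb M$ is reflexive if the natural morphism $\mathbb M\to\mathbb M^{**}$ is an isomorphism. For an $R$-scheme $X$, $X^{\cdot}(R'):=\mathrm{Hom}_{R\text{-}sch}(\mathrm{Spec}\,R',X)$.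 An $R$-module scheme is a commutative group $R$-scheme $X$ with a morphism $\mathbb A^1_R\times_R X\to X$ satisfying the module axioms; an $\mathcal R$-module scheme is an $\mathcal R$-module isomorphic to $X^{\cdot}$ for an $R$-module scheme $X$; it is an $\mathcal R$-module affine scheme if $X$ is affine. An $\mathcal R$-submodule (affine) scheme of $\mathcal M$ is an $\mathcal R$-submodule of $\mathcal M$ that is an $\mathcal R$-module (affine) scheme. The reflexive $\mathcal R$-module affine schemes are exactly the $\mathcal R$-modules isomorphic to $\mathcal N^*$ for some $R$-module $N$. *)

(* Defs.v *)
From HB Require Import structures.
From mathcomp Require Import all_boot all_order all_algebra.
From mathcomp Require Import boolp.

Set Implicit Arguments.
Unset Strict Implicit.
Unset Printing Implicit Defensive.

Import GRing.Theory.
Local Open Scope ring_scope.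
Local Open Scope quotient_scope.

(* [comAlgType R] excludes the zero algebra, and changing the base ring of
   a [comAlgType] is awkward; an algebra is therefore a commutative ring
   together with its structure morphism. *)
Record calg (R : comPzRingType) := CAlg {
  calg_ring :> comPzRingType;
  calg_str : {rmorphism R -> calg_ring} }.
Arguments CAlg {R} calg_ring calg_str.
Arguments calg_str {R} c.

Record calg_hom (R : comPzRingType) (A B : calg R) := CAlgHom {
  calg_fun :> {rmorphism A -> B};
  calg_homE : forall r, calg_fun (calg_str A r) = calg_str B r }.
Arguments CAlgHom {R A B} calg_fun calg_homE.

Section CAlg.
Variable R : comPzRingType.

Lemma calg_hom_inj (A B : calg R) (f g : calg_hom A B) : f =1 g -> f = g.
Proof.
case: f g => [[f cf] fE] [[g cg] gE] /= fg.
have {}fg : f = g by apply: funext.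
case: _ / fg in cg gE *.
have cfg : cf = cg.
  case: cf fE => -[a] [b] fE; case: cg gE => -[c] [d] gE.
  by rewrite (Prop_irrelevance a c) (Prop_irrelevance b d).
by case: _ / cfg in gE *; rewrite (Prop_irrelevance fE gE).
Qed.

Definition calg_id (A : calg R) : calg_hom A A :=
  @CAlgHom R A A idfun (fun=> erefl).

Lemma calg_comp_subproof (A B C : calg R)
    (g : calg_hom B C) (f : calg_hom A B) r :
  (g \o f : {rmorphism A -> C}) (calg_str A r) = calg_str C r.
Proof. by rewrite /= !calg_homE. Qed.

Definition calg_comp (A B C : calg R) (g : calg_hom B C) (f : calg_hom A B) :
    calg_hom A C :=
  CAlgHom (g \o f) (calg_comp_subproof g f).

Definition calg_restr (A : calg R) (B : calg A) : calg R :=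
  CAlg B (calg_str B \o calg_str A).

Lemma calg_restr_hom_subproof (A : calg R) (B C : calg A)
    (h : calg_hom B C) r :
  h (calg_str (calg_restr B) r) = calg_str (calg_restr C) r.
Proof. exact: calg_homE. Qed.

Definition calg_restr_hom (A : calg R) (B C : calg A) (h : calg_hom B C) :
    calg_hom (calg_restr B) (calg_restr C) :=
  @CAlgHom R (calg_restr B) (calg_restr C) h (calg_restr_hom_subproof h).

(* The structure morphism A -> B of an A-algebra B, as an R-algebra morphism. *)
Definition calg_unit (A : calg R) (B : calg A) : calg_hom A (calg_restr B) :=
  @CAlgHom R A (calg_restr B) (calg_str B) (fun=> erefl).

(* A B-algebra C, regarded as an A-algebra through h : A -> B. *)
Definition calg_via (A B : calg R) (h : calg_hom A B) (C : calg B) : calg A :=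
  CAlg C (calg_str C \o h).

Definition calg_via_hom (A B : calg R) (h : calg_hom A B) (C D : calg B)
    (k : calg_hom C D) : calg_hom (calg_via h C) (calg_via h D) :=
  @CAlgHom A (calg_via h C) (calg_via h D) k (fun a => calg_homE k (h a)).

(* The two R-algebra structures on a B-algebra C, through B and through
   A -> B, agree, though not definitionally; the comparison isomorphism is
   the identity of C. *)
Lemma calg_via_iso_subproof (A B : calg R) (h : calg_hom A B) (C : calg B) r :
  idfun (calg_str (calg_restr C) r) = calg_str (calg_restr (calg_via h C)) r.
Proof. by rewrite /= calg_homE. Qed.

Definition calg_via_iso (A B : calg R) (h : calg_hom A B) (C : calg B) :
    calg_hom (calg_restr C) (calg_restr (calg_via h C)) :=
  @CAlgHom R (calg_restr C) (calg_restr (calg_via h C)) idfun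
    (calg_via_iso_subproof h C).

Definition calg_self (A : calg R) : calg A := CAlg A idfun.

End CAlg.

(* The values of a functor are bare types rather than [lmodType]s: the
   elements of a dual are families indexed by all R-algebras, and so live in
   a universe above the one of the carriers of MathComp structures. *)
Record sfunctor (R : comPzRingType) := SFunctor {
  sobj :> calg R -> Type;
  smap : forall A B : calg R, calg_hom A B -> sobj A -> sobj B;
  smap_id : forall A x, smap (calg_id A) x = x;
  smap_comp : forall A B C (g : calg_hom B C) (f : calg_hom A B) x,
    smap (calg_comp g f) x = smap g (smap f x) }.

Lemma smap_eq (R : comPzRingType) (F : sfunctor R) (A B : calg R)
    (h k : calg_hom A B) (x : F A) : h =1 k -> smap h x = smap k x.
Proof. by move=> /calg_hom_inj ->. Qed.

Record module_on (R : comPzRingType) (F : sfunctor R) := ModuleOn {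
  mo_zero : forall A, F A;
  mo_opp : forall A, F A -> F A;
  mo_add : forall A, F A -> F A -> F A;
  mo_scale : forall A : calg R, A -> F A -> F A;
  mo_addA : forall A, associative (@mo_add A);
  mo_addC : forall A, commutative (@mo_add A);
  mo_add0 : forall A, left_id (mo_zero A) (@mo_add A);
  mo_addN : forall A, left_inverse (mo_zero A) (@mo_opp A) (@mo_add A);
  mo_scaleA : forall (A : calg R) (a b : A) x,
    mo_scale a (mo_scale b x) = mo_scale (a * b) x;
  mo_scale1 : forall (A : calg R) (x : F A), mo_scale 1 x = x;
  mo_scaleDr : forall (A : calg R) (a : A) x y,
    mo_scale a (mo_add x y) = mo_add (mo_scale a x) (mo_scale a y);
  mo_scaleDl : forall (A : calg R) (a b : A) x,
    mo_scale (a + b) x = mo_add (mo_scale a x) (mo_scale b x);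
  mo_mapD : forall (A B : calg R) (f : calg_hom A B) x y,
    smap f (mo_add x y) = mo_add (smap f x) (smap f y);
  mo_mapZ : forall (A B : calg R) (f : calg_hom A B) a x,
    smap f (mo_scale a x) = mo_scale (f a) (smap f x) }.

Record rmodule (R : comPzRingType) := RModule {
  rm_fun :> sfunctor R;
  rm_mod : module_on rm_fun }.
Arguments RModule {R} rm_fun rm_mod.

Section RModuleOps.
Variables (R : comPzRingType) (F : rmodule R) (A : calg R).
Definition rzero : F A := mo_zero (rm_mod F) A.
Definition ropp (x : F A) : F A := mo_opp (rm_mod F) x.
Definition radd (x y : F A) : F A := mo_add (rm_mod F) x y.
Definition rscale (a : A) (x : F A) : F A := mo_scale (rm_mod F) a x.
End RModuleOps.
Arguments rzero {R F A}.

Record rmor (R : comPzRingType) (F G : rmodule R) := RMor {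
  rmor_fun :> forall A : calg R, F A -> G A;
  rmor_nat : forall (A B : calg R) (h : calg_hom A B) x,
    rmor_fun (smap h x) = smap h (rmor_fun x);
  rmorD : forall (A : calg R) (x y : F A),
    rmor_fun (radd x y) = radd (rmor_fun x) (rmor_fun y);
  rmorZ : forall (A : calg R) (a : A) (x : F A),
    rmor_fun (rscale a x) = rscale a (rmor_fun x) }.
Arguments rmor_fun {R F G} r A _.

Definition rmono (R : comPzRingType) (F G : rmodule R) (f : rmor F G) :=
  forall A : calg R, injective (f A).

Definition is_riso (R : comPzRingType) (F G : rmodule R) (f : rmor F G) :=
  exists g : rmor G F,
    forall A : calg R, cancel (f A) (g A) /\ cancel (g A) (f A).

Definition risomorphic (R : comPzRingType) (F G : rmodule R) :=
  exists f : rmor F G, is_riso f.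

Section RModuleTheory.
Variables (R : comPzRingType).
Implicit Types F G : rmodule R.

Lemma rmor_inj F G (f g : rmor F G) : (forall A x, f A x = g A x) -> f = g.
Proof.
case: f g => [f fn fD fZ] [g gn gD gZ] /= fg.
have {}fg : f = g.
  by apply: functional_extensionality_dep => A; apply: funext => x.
case: _ / fg in gn gD gZ *.
by rewrite (Prop_irrelevance fn gn) (Prop_irrelevance fD gD)
           (Prop_irrelevance fZ gZ).
Qed.

Lemma raddA F A : associative (@radd R F A).
Proof. exact: mo_addA. Qed.
Lemma raddC F A : commutative (@radd R F A).
Proof. exact: mo_addC. Qed.
Lemma radd0 F A : left_id rzero (@radd R F A).
Proof. exact: mo_add0. Qed.
Lemma raddN F A : left_inverse rzero (@ropp R F A) (@radd R F A).
Proof. exact: mo_addN. Qed.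
Lemma rscaleA F (A : calg R) (a b : A) (x : F A) :
  rscale a (rscale b x) = rscale (a * b) x.
Proof. exact: mo_scaleA. Qed.
Lemma rscale1 F (A : calg R) (x : F A) : rscale 1 x = x.
Proof. exact: mo_scale1. Qed.
Lemma rscaleDr F (A : calg R) (a : A) (x y : F A) :
  rscale a (radd x y) = radd (rscale a x) (rscale a y).
Proof. exact: mo_scaleDr. Qed.
Lemma rscaleDl F (A : calg R) (a b : A) (x : F A) :
  rscale (a + b) x = radd (rscale a x) (rscale b x).
Proof. exact: mo_scaleDl. Qed.
Lemma rmapD F (A B : calg R) (f : calg_hom A B) (x y : F A) :
  smap f (radd x y) = radd (smap f x) (smap f y).
Proof. exact: mo_mapD. Qed.
Lemma rmapZ F (A B : calg R) (f : calg_hom A B) a (x : F A) :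
  smap f (rscale a x) = rscale (f a) (smap f x).
Proof. exact: mo_mapZ. Qed.

Lemma raddI F A (x y z : F A) : radd x y = radd x z -> y = z.
Proof.
move=> /(congr1 (radd (ropp x))).
by rewrite !raddA raddN !radd0.
Qed.

Lemma raddr0 F A (x : F A) : radd x rzero = x.
Proof. by rewrite raddC radd0. Qed.

Lemma rscale0 F (A : calg R) (x : F A) : rscale 0 x = rzero.
Proof.
by apply: (@raddI _ _ (rscale 0 x)); rewrite -rscaleDl addr0 raddr0.
Qed.

Lemma rscaler0 F (A : calg R) (a : A) : rscale a (@rzero R F A) = rzero.
Proof.
by apply: (@raddI _ _ (rscale a rzero)); rewrite -rscaleDr !raddr0.
Qed.

Lemma rscaleN1 F (A : calg R) (x : F A) : rscale (-1) x = ropp x.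
Proof.
apply: (@raddI _ _ x).
by rewrite -{1}[x]rscale1 -rscaleDl subrr rscale0 raddC raddN.
Qed.

Lemma rmap0 F (A B : calg R) (f : calg_hom A B) : smap f (@rzero R F A) = rzero.
Proof. by rewrite -(rscale0 rzero) rmapZ rmorph0 rscale0. Qed.

Lemma rmor0 F G (f : rmor F G) A : f A rzero = rzero.
Proof. by rewrite -(rscale0 rzero) rmorZ rscale0. Qed.

Definition rmor_id F : rmor F F :=
  @RMor R F F (fun _ x => x) (fun _ _ _ _ => erefl) (fun _ _ _ => erefl)
    (fun _ _ _ => erefl).

Lemma rmor_comp_nat F G H (g : rmor G H) (f : rmor F G) (A B : calg R)
    (h : calg_hom A B) x : g B (f B (smap h x)) = smap h (g A (f A x)).
Proof. by rewrite !rmor_nat. Qed.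
Lemma rmor_compD F G H (g : rmor G H) (f : rmor F G) A x y :
  g A (f A (radd x y)) = radd (g A (f A x)) (g A (f A y)).
Proof. by rewrite !rmorD. Qed.
Lemma rmor_compZ F G H (g : rmor G H) (f : rmor F G) (A : calg R) (a : A) x :
  g A (f A (rscale a x)) = rscale a (g A (f A x)).
Proof. by rewrite !rmorZ. Qed.

Definition rmor_comp F G H (g : rmor G H) (f : rmor F G) : rmor F H :=
  @RMor R F H (fun A x => g A (f A x)) (rmor_comp_nat g f)
    (rmor_compD g f) (rmor_compZ g f).

Definition struct_fun : sfunctor R :=
  @SFunctor R (fun A => A) (fun _ _ f => f) (fun _ _ => erefl)
    (fun _ _ _ _ _ _ => erefl).

Definition struct_mod : rmodule R :=
  RModule struct_fun
    (@ModuleOn R struct_fun (fun=> 0) (fun _ x => - x) (fun _ x y => x + y)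
       (fun _ a x => a * x) (fun A => @addrA A) (fun A => @addrC A)
       (fun A => @add0r A) (fun A => @addNr A) (fun A => @mulrA A)
       (fun A => @mul1r A) (fun A => @mulrDr A) (fun A => @mulrDl A)
       (fun _ _ f => rmorphD f) (fun _ _ f => rmorphM f)).

Variable n : nat.

Definition free_fun : sfunctor R :=
  @SFunctor R (fun A => 'rV[A]_n) (fun _ _ f => map_mx f)
    (fun A x => map_mx_id (fun=> erefl) x)
    (fun _ _ _ g f x => map_mx_comp f g x).

Definition free_mod : rmodule R :=
  RModule free_fun
    (@ModuleOn R free_fun (fun=> 0) (fun _ x => - x) (fun _ x y => x + y)
       (fun _ a x => a *: x) (fun A => @addrA 'rV[A]_n)
       (fun A => @addrC 'rV[A]_n) (fun A => @add0r 'rV[A]_n)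
       (fun A => @addNr 'rV[A]_n) (fun A => @scalerA A 'rV[A]_n)
       (fun A => @scale1r A 'rV[A]_n) (fun A => @scalerDr A 'rV[A]_n)
       (fun A a b x => @scalerDl A 'rV[A]_n x a b)
       (fun _ _ f => @map_mxD _ _ f 1 n) (fun _ _ f => @map_mxZ _ _ f 1 n)).

End RModuleTheory.

Record submodule (R : comPzRingType) (F : rmodule R) := Submodule {
  sm_pred :> forall A : calg R, F A -> Prop;
  sm_zero : forall A, sm_pred (@rzero R F A);
  sm_add : forall A (x y : F A), sm_pred x -> sm_pred y -> sm_pred (radd x y);
  sm_scale : forall (A : calg R) (a : A) (x : F A),
    sm_pred x -> sm_pred (rscale a x);
  sm_map : forall (A B : calg R) (h : calg_hom A B) (x : F A),
    sm_pred x -> sm_pred (smap h x) }.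
Arguments sm_pred {R F} s A _.

Lemma sval_inj (T : Type) (P : T -> Prop) (u v : {x | P x}) :
  sval u = sval v -> u = v.
Proof.
case: u v => [x Px] [y Py] /= xy; case: _ / xy in Py *.
by rewrite (Prop_irrelevance Px Py).
Qed.

Section Submodule.
Variables (R : comPzRingType) (F : rmodule R) (S : submodule F).

Lemma sm_opp (A : calg R) (x : F A) : S A x -> S A (ropp x).
Proof. by rewrite -rscaleN1; apply: sm_scale. Qed.

Let car (A : calg R) := {x : F A | S A x}.
Let mk (A : calg R) (x : F A) (Sx : S A x) : car A := exist _ x Sx.

Let cmap (A B : calg R) (h : calg_hom A B) (u : car A) : car B :=
  mk (sm_map h (svalP u)).
Let cmap_id (A : calg R) u : cmap (calg_id A) u = u.
Proof. by apply: sval_inj; apply: smap_id. Qed.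
Let cmap_comp (A B C : calg R) (g : calg_hom B C) (f : calg_hom A B) u :
  cmap (calg_comp g f) u = cmap g (cmap f u).
Proof. by apply: sval_inj; apply: smap_comp. Qed.

Definition sub_fun : sfunctor R := @SFunctor R car cmap cmap_id cmap_comp.

Let cadd (A : calg R) (u v : car A) := mk (sm_add (svalP u) (svalP v)).
Let copp (A : calg R) (u : car A) := mk (sm_opp (svalP u)).
Let cscale (A : calg R) (a : A) (u : car A) := mk (sm_scale a (svalP u)).

Definition sub_on : module_on sub_fun.
Proof.
refine (@ModuleOn R sub_fun (fun A => mk (sm_zero S A)) copp cadd cscale
  _ _ _ _ _ _ _ _ _ _).
- by move=> A u v w; apply: sval_inj; apply: raddA.
- by move=> A u v; apply: sval_inj; apply: raddC.
- by move=> A u; apply: sval_inj; apply: radd0.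
- by move=> A u; apply: sval_inj; apply: raddN.
- by move=> A a b u; apply: sval_inj; apply: rscaleA.
- by move=> A u; apply: sval_inj; apply: rscale1.
- by move=> A a u v; apply: sval_inj; apply: rscaleDr.
- by move=> A a b u; apply: sval_inj; apply: rscaleDl.
- by move=> A B f u v; apply: sval_inj; apply: rmapD.
- by move=> A B f a u; apply: sval_inj; apply: rmapZ.
Defined.

Definition sub_mod : rmodule R := RModule sub_fun sub_on.

Definition sub_incl : rmor sub_mod F :=
  @RMor R sub_mod F (fun _ u => sval u) (fun _ _ _ _ => erefl)
    (fun _ _ _ => erefl) (fun _ _ _ => erefl).

End Submodule.

Section SubIncl.
Variables (R : comPzRingType) (F : rmodule R).

Definition sub_le (S T : submodule F) : Prop :=
  forall A (x : F A), S A x -> T A x.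

Definition sub_le_mor (S T : submodule F) (le_ST : sub_le S T) :
  rmor (sub_mod S) (sub_mod T).
Proof.
refine (@RMor R (sub_mod S) (sub_mod T)
  (fun A u => exist _ (sval u) (le_ST A _ (svalP u))) _ _ _);
  by move=> *; apply: sval_inj.
Defined.

End SubIncl.

Definition ker (R : comPzRingType) (F G : rmodule R) (f : rmor F G) :
  submodule F.
Proof.
refine (@Submodule R F (fun A x => f A x = rzero) _ _ _ _).
- exact: rmor0.
- by move=> A x y fx fy; rewrite rmorD fx fy radd0.
- by move=> A a x fx; rewrite rmorZ fx rscaler0.
- by move=> A B h x fx; rewrite rmor_nat fx rmap0.
Defined.

Section Restriction.
Variables (R : comPzRingType) (F : rmodule R) (A : calg R).

Let rmap (B C : calg A) (h : calg_hom B C) :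
  F (calg_restr B) -> F (calg_restr C) := smap (calg_restr_hom h).
Let rmap_id (B : calg A) x : rmap (calg_id B) x = x.
Proof.
rewrite -[RHS]smap_id; exact: smap_eq.
Qed.
Let rmap_comp (B C D : calg A) (g : calg_hom C D) (f : calg_hom B C) x :
  rmap (calg_comp g f) x = rmap g (rmap f x).
Proof.
rewrite /rmap -smap_comp; exact: smap_eq.
Qed.

Definition restr_fun : sfunctor A :=
  @SFunctor A (fun B => F (calg_restr B)) rmap rmap_id rmap_comp.

Definition restr_mod : rmodule A :=
  RModule restr_fun
    (@ModuleOn A restr_fun (fun B => @rzero R F (calg_restr B))
      (fun B => @ropp R F (calg_restr B)) (fun B => @radd R F (calg_restr B))
      (fun B => @rscale R F (calg_restr B))
      (fun B => @raddA R F (calg_restr B)) (fun B => @raddC R F (calg_restr B))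
      (fun B => @radd0 R F (calg_restr B)) (fun B => @raddN R F (calg_restr B))
      (fun B => @rscaleA R F (calg_restr B))
      (fun B => @rscale1 R F (calg_restr B))
      (fun B => @rscaleDr R F (calg_restr B))
      (fun B => @rscaleDl R F (calg_restr B))
      (fun _ _ f => rmapD (calg_restr_hom f))
      (fun _ _ f => rmapZ (calg_restr_hom f))).

End Restriction.

Section Dual.
Variables (R : comPzRingType) (F : rmodule R).

Let car (A : calg R) := rmor (restr_mod F A) (struct_mod A).

(* For w : F|A -> A and h : A -> B, the value of the image of w at a
   B-algebra C is the value of w at C seen as an A-algebra. *)
Definition dual_map (A B : calg R) (h : calg_hom A B) (w : car A) : car B.
Proof.
refine (@RMor B (restr_mod F B) (struct_mod B)
  (fun C x => w (calg_via h C) (@smap R F _ _ (calg_via_iso h C) x)) _ _ _).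
- move=> C D k x /=.
  rewrite -[RHS](rmor_nat w (calg_via_hom h k)) /= -!smap_comp.
  f_equal; exact: smap_eq.
- move=> C x y /=; rewrite rmapD; exact (@rmorD _ _ _ w (calg_via h C) _ _).
- move=> C c x /=; rewrite rmapZ; exact (@rmorZ _ _ _ w (calg_via h C) _ _).
Defined.

Lemma dual_map_id (A : calg R) (w : car A) : dual_map (calg_id A) w = w.
Proof.
apply: rmor_inj => C x /=.
pose k : calg_hom (calg_via (calg_id A) C) C :=
  @CAlgHom A (calg_via (calg_id A) C) C idfun (fun=> erefl).
have := rmor_nat w k (@smap R F _ _ (calg_via_iso (calg_id A) C) x).
rewrite /= -smap_comp => <-; f_equal.
rewrite -[RHS](@smap_id R F); exact: (@smap_eq R F).
Qed.

Lemma dual_map_comp (A B C : calg R) (g : calg_hom B C) (f : calg_hom A B)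
    (w : car A) : dual_map (calg_comp g f) w = dual_map g (dual_map f w).
Proof.
apply: rmor_inj => D x /=; rewrite -smap_comp.
pose k : calg_hom (calg_via f (calg_via g D)) (calg_via (calg_comp g f) D) :=
  @CAlgHom A (calg_via f (calg_via g D)) (calg_via (calg_comp g f) D) idfun
    (fun=> erefl).
have := rmor_nat w k
  (@smap R F _ _ (calg_comp (calg_via_iso f (calg_via g D)) (calg_via_iso g D))
     x).
rewrite /= -smap_comp => <-.
f_equal; exact: smap_eq.
Qed.

Definition dual_fun : sfunctor R :=
  @SFunctor R car dual_map dual_map_id dual_map_comp.

Definition dual_zero (A : calg R) : car A.
Proof.
refine (@RMor A (restr_mod F A) (struct_mod A) (fun _ _ => 0) _ _ _).
- by move=> B C h x /=; rewrite rmorph0.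
- by move=> B x y; rewrite /radd /= addr0.
- by move=> B b x; rewrite /rscale /= mulr0.
Defined.

Definition dual_opp (A : calg R) (w : car A) : car A.
Proof.
refine (@RMor A (restr_mod F A) (struct_mod A) (fun B x => - w B x) _ _ _).
- by move=> B C h x; rewrite rmor_nat /= rmorphN.
- by move=> B x y; rewrite rmorD /radd /= opprD.
- by move=> B b x; rewrite rmorZ /rscale /= mulrN.
Defined.

Definition dual_add (A : calg R) (v w : car A) : car A.
Proof.
refine (@RMor A (restr_mod F A) (struct_mod A)
  (fun B x => (v B x : B) + w B x) _ _ _).
- by move=> B C h x; rewrite !rmor_nat /= rmorphD.
- by move=> B x y; rewrite !rmorD /radd /= addrACA.
- by move=> B b x; rewrite !rmorZ /rscale /= mulrDr.
Defined.

Definition dual_scale (A : calg R) (a : A) (w : car A) : car A.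
Proof.
refine (@RMor A (restr_mod F A) (struct_mod A)
  (fun B x => calg_str B a * w B x) _ _ _).
- by move=> B C h x; rewrite rmor_nat /= rmorphM calg_homE.
- by move=> B x y; rewrite rmorD /radd /= mulrDr.
- by move=> B b x; rewrite rmorZ /rscale /= mulrCA.
Defined.

Definition dual_on : module_on dual_fun.
Proof.
refine (@ModuleOn R dual_fun dual_zero dual_opp dual_add dual_scale
  _ _ _ _ _ _ _ _ _ _).
- by move=> A u v w; apply: rmor_inj => B x /=; rewrite addrA.
- by move=> A u v; apply: rmor_inj => B x /=; rewrite addrC.
- by move=> A u; apply: rmor_inj => B x /=; rewrite add0r.
- by move=> A u; apply: rmor_inj => B x /=; rewrite addNr.
- by move=> A a b u; apply: rmor_inj => B x /=; rewrite rmorphM mulrA.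
- by move=> A u; apply: rmor_inj => B x /=; rewrite rmorph1 mul1r.
- by move=> A a u v; apply: rmor_inj => B x /=; rewrite mulrDr.
- by move=> A a b u; apply: rmor_inj => B x /=; rewrite rmorphD mulrDl.
- by move=> A B f u v; apply: rmor_inj.
- by move=> A B f a u; apply: rmor_inj.
Defined.

Definition dual : rmodule R := RModule dual_fun dual_on.

End Dual.

Section Reflexive.
Variables (R : comPzRingType) (F : rmodule R).

(* x in F(A) is sent to the form on (F^* )|A which maps w in F^*(B) to
   w_B (x_B), B being an A-algebra and x_B the image of x in F(B). *)
Definition bidual_at (A : calg R) (x : F A) : dual (dual F) A.
Proof.
refine (@RMor A (restr_mod (dual F) A) (struct_mod A)
  (fun B (w : dual F (calg_restr B)) => w (calg_self (calg_restr B))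
     (smap (calg_unit (calg_self (calg_restr B))) (smap (calg_unit B) x)))
  _ _ _); last 2 first.
- by move=> B v w.
- by move=> B b w.
move=> B C h w /=.
pose k : calg_hom (calg_self (calg_restr B))
    (calg_via (calg_restr_hom h) (calg_self (calg_restr C))) :=
  @CAlgHom (calg_restr B) (calg_self (calg_restr B))
    (calg_via (calg_restr_hom h) (calg_self (calg_restr C))) h (fun=> erefl).
rewrite -[RHS](rmor_nat w k) /= -!smap_comp; f_equal; apply: smap_eq.
by move=> a /=; rewrite calg_homE.
Defined.

Definition bidual : rmor F (dual (dual F)).
Proof.
refine (@RMor R F (dual (dual F)) bidual_at _ _ _).
- move=> A B h x; apply: rmor_inj => C w /=; rewrite -!smap_comp.
  pose k : calg_hom (calg_self (calg_restr C))
      (calg_via (calg_via_iso h C) (calg_self (calg_restr (calg_via h C)))) :=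
    @CAlgHom (calg_restr C) (calg_self (calg_restr C))
      (calg_via (calg_via_iso h C) (calg_self (calg_restr (calg_via h C))))
      idfun (fun=> erefl).
  have := rmor_nat w k; rewrite /= => <-; rewrite -!smap_comp.
  f_equal; exact: smap_eq.
- move=> A x y; apply: rmor_inj => B w /=.
  by rewrite !rmapD (rmorD w).
- move=> A a x; apply: rmor_inj => B w /=.
  by rewrite !rmapZ (rmorZ w).
Defined.

Definition reflexive_mod : Prop := is_riso bidual.

End Reflexive.

Section Affine.
Variable R : comPzRingType.

Definition spec_fun (A : calg R) : sfunctor R.
Proof.
refine (@SFunctor R (fun B => calg_hom A B) (fun _ _ h f => calg_comp h f) _ _);
  by move=> *; apply: calg_hom_inj.
Defined.

(* By the Yoneda lemma, the group law and the scalar multiplication of an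
   R-module scheme with underlying scheme Spec A amount to natural
   operations on its functor of points. *)
Definition affine_mod (F : rmodule R) : Prop :=
  exists (A : calg R) (s : module_on (spec_fun A)),
    risomorphic F (RModule (spec_fun A) s).

Definition reflexive_affine_mod (F : rmodule R) : Prop :=
  reflexive_mod F /\ affine_mod F.

End Affine.

Section TensorRel.
Variables (R : comPzRingType) (M : lmodType R) (A : calg R).

(* A list stands for the formal sum of its entries, and (m, a) for m (x) a. *)
Inductive tensor_rel : seq (M * A) -> seq (M * A) -> Prop :=
| TensorRefl s : tensor_rel s s
| TensorSym s t : tensor_rel s t -> tensor_rel t s
| TensorTrans s t u : tensor_rel s t -> tensor_rel t u -> tensor_rel s u
| TensorCat s s' t t' : tensor_rel s s' -> tensor_rel t t' ->
    tensor_rel (s ++ t) (s' ++ t')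
| TensorCatC s t : tensor_rel (s ++ t) (t ++ s)
| TensorDl m m' a : tensor_rel [:: (m + m', a)] [:: (m, a); (m', a)]
| TensorDr m a a' : tensor_rel [:: (m, a + a')] [:: (m, a); (m, a')]
| TensorZ r m a : tensor_rel [:: (r *: m, a)] [:: (m, calg_str A r * a)]
| Tensor0 a : tensor_rel [:: (0, a)] [::].

End TensorRel.

Lemma tensor_rel_map (R : comPzRingType) (M : lmodType R) (A B : calg R)
    (h : A -> B) :
  {morph h : a a' / a + a'} ->
  (forall r a, h (calg_str A r * a) = calg_str B r * h a) ->
  forall s t : seq (M * A), tensor_rel s t ->
    tensor_rel [seq (p.1, h p.2) | p <- s] [seq (p.1, h p.2) | p <- t].
Proof.
move=> hD hZ s t; elim=> {s t} /=.
- by move=> s; apply: TensorRefl.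
- by move=> s t _; apply: TensorSym.
- by move=> s t u _ + _; apply: TensorTrans.
- by move=> s s' t t' _ + _; rewrite !map_cat; apply: TensorCat.
- by move=> s t; rewrite !map_cat; apply: TensorCatC.
- by move=> *; apply: TensorDl.
- by move=> *; rewrite hD; apply: TensorDr.
- by move=> *; rewrite hZ; apply: TensorZ.
- by move=> *; apply: Tensor0.
Qed.

Section Tensor.
Variables (R : comPzRingType) (M : lmodType R) (A : calg R).

Definition tensor_relb (s t : seq (M * A)) : bool := `[< tensor_rel s t >].

Lemma tensor_relb_refl : reflexive tensor_relb.
Proof. by move=> s; apply/asboolP/TensorRefl. Qed.
Lemma tensor_relb_sym : symmetric tensor_relb.
Proof. by move=> s t; apply/asboolP/asboolP => /TensorSym. Qed.
Lemma tensor_relb_trans : transitive tensor_relb.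
Proof.
move=> t s u /asboolP st /asboolP tu; apply/asboolP; exact: TensorTrans st tu.
Qed.

Canonical tensor_equiv :=
  EquivRel tensor_relb tensor_relb_refl tensor_relb_sym tensor_relb_trans.

Definition tensor := {eq_quot tensor_equiv}.

HB.instance Definition _ := Choice.on tensor.

Definition tensor_pi (s : seq (M * A)) : tensor := \pi_tensor s.
Definition tmul (m : M) (a : A) : tensor := tensor_pi [:: (m, a)].

Lemma tensor_piP s t : tensor_pi s = tensor_pi t <-> tensor_rel s t.
Proof.
split=> [/eqmodP /asboolP //|st].
by apply/eqmodP/asboolP.
Qed.

Lemma tensor_ind (P : tensor -> Prop) :
  (forall s, P (tensor_pi s)) -> forall x, P x.
Proof. by move=> Ppi x; rewrite -[x]reprK; apply: Ppi. Qed.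

Lemma tensor_repr s : tensor_rel (repr (tensor_pi s)) s.
Proof. by apply/tensor_piP; rewrite /tensor_pi reprK. Qed.

Definition tensor_add (x y : tensor) := tensor_pi (repr x ++ repr y).
Definition tensor_scale (b : A) (x : tensor) :=
  tensor_pi [seq (p.1, b * p.2) | p <- repr x].
Definition tensor_opp (x : tensor) := tensor_scale (-1) x.

Lemma tensor_addE s t :
  tensor_add (tensor_pi s) (tensor_pi t) = tensor_pi (s ++ t).
Proof. by apply/tensor_piP/TensorCat; apply: tensor_repr. Qed.

Lemma tensor_scaleE b s :
  tensor_scale b (tensor_pi s) = tensor_pi [seq (p.1, b * p.2) | p <- s].
Proof.
apply/tensor_piP; apply: tensor_rel_map (tensor_repr s) => /= [a a'|r a].
- exact: mulrDr.
- exact: mulrCA.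
Qed.

Lemma tensor_addA : associative tensor_add.
Proof.
elim/tensor_ind=> s; elim/tensor_ind=> t; elim/tensor_ind=> u.
by rewrite !tensor_addE catA.
Qed.

Lemma tensor_addC : commutative tensor_add.
Proof.
elim/tensor_ind=> s; elim/tensor_ind=> t.
by rewrite !tensor_addE; apply/tensor_piP/TensorCatC.
Qed.

Lemma tensor_add0 : left_id (tensor_pi [::]) tensor_add.
Proof. by elim/tensor_ind=> s; rewrite tensor_addE. Qed.

Lemma tensor_rel0 m : tensor_rel (A := A) [:: (m : M, 0)] [::].
Proof.
have := @TensorZ R M A 0 m 0; rewrite mulr0 scale0r => /TensorSym h.
exact: TensorTrans h (Tensor0 M 0).
Qed.

Lemma tensor_scaleDl b c x :
  tensor_scale (b + c) x = tensor_add (tensor_scale b x) (tensor_scale c x).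
Proof.
elim/tensor_ind: x => s; rewrite !tensor_scaleE tensor_addE.
apply/tensor_piP; elim: s => [|[m a] s IHs] /=; first exact: TensorRefl.
rewrite mulrDl -cat1s.
apply: TensorTrans (TensorCat (TensorDr _ _ _) IHs) _.
rewrite -[_ :: (_ ++ _)]cat1s -[X in tensor_rel X]/([:: (m, b * a)] ++
  ([:: (m, c * a)] ++ (_ ++ _))).
apply: TensorCat (TensorRefl _) _.
rewrite -[(m, c * a) :: [seq _ | _ <- s]]cat1s !catA.
exact: TensorCat (TensorCatC _ _) (TensorRefl _).
Qed.

Lemma tensor_scale0 x : tensor_scale 0 x = tensor_pi [::].
Proof.
elim/tensor_ind: x => s; rewrite tensor_scaleE; apply/tensor_piP.
elim: s => [|[m a] s IHs] /=; first exact: TensorRefl.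
by rewrite mul0r -cat1s; apply: TensorCat (tensor_rel0 m) IHs.
Qed.

Lemma tensor_scale1 x : tensor_scale 1 x = x.
Proof.
elim/tensor_ind: x => s; rewrite tensor_scaleE; congr tensor_pi.
by rewrite -[RHS]map_id; apply: eq_map => -[m a] /=; rewrite mul1r.
Qed.

Lemma tensor_addN : left_inverse (tensor_pi [::]) tensor_opp tensor_add.
Proof.
move=> x; rewrite -{2}[x]tensor_scale1 -tensor_scaleDl addNr.
exact: tensor_scale0.
Qed.

Lemma tensor_scaleA b c x :
  tensor_scale b (tensor_scale c x) = tensor_scale (b * c) x.
Proof.
elim/tensor_ind: x => s; rewrite !tensor_scaleE -map_comp; congr tensor_pi.
by apply: eq_map => -[m a] /=; rewrite mulrA.
Qed.

Lemma tensor_scaleDr b : {morph tensor_scale b : x y / tensor_add x y}.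
Proof.
elim/tensor_ind=> s; elim/tensor_ind=> t.
by rewrite !(tensor_addE, tensor_scaleE) map_cat.
Qed.

HB.instance Definition _ := GRing.isZmodule.Build tensor
  tensor_addA tensor_addC tensor_add0 tensor_addN.

HB.instance Definition _ := GRing.Zmodule_isLmodule.Build A tensor
  tensor_scaleA tensor_scale1 tensor_scaleDr
  (fun x b c => tensor_scaleDl b c x).

End Tensor.

Section QCoh.
Variables (R : comPzRingType) (M : lmodType R).

Definition tensor_map (A B : calg R) (h : calg_hom A B) (x : tensor M A) :
  tensor M B := tensor_pi [seq (p.1, h p.2) | p <- repr x].

Lemma tensor_mapE (A B : calg R) (h : calg_hom A B) s :
  tensor_map h (tensor_pi s) = tensor_pi [seq (p.1, h p.2) | p <- s].
Proof.
apply/tensor_piP; apply: tensor_rel_map (tensor_repr s) => [a a'|r a].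
- exact: rmorphD.
- by rewrite rmorphM calg_homE.
Qed.

Lemma tensor_map_id (A : calg R) x : tensor_map (calg_id A) x = x.
Proof.
elim/tensor_ind: x => s; rewrite tensor_mapE; congr tensor_pi.
by rewrite -[RHS]map_id; apply: eq_map => -[].
Qed.

Lemma tensor_map_comp (A B C : calg R) (g : calg_hom B C) (f : calg_hom A B) x :
  tensor_map (calg_comp g f) x = tensor_map g (tensor_map f x).
Proof. by elim/tensor_ind: x => s; rewrite !tensor_mapE -map_comp. Qed.

Lemma tensor_mapD (A B : calg R) (h : calg_hom A B) (x y : tensor M A) :
  tensor_map h (x + y) = tensor_map h x + tensor_map h y.
Proof.
elim/tensor_ind: x => s; elim/tensor_ind: y => t.
rewrite [_ s + _]tensor_addE !tensor_mapE map_cat.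
by rewrite [RHS]tensor_addE.
Qed.

Lemma tensor_mapZ (A B : calg R) (h : calg_hom A B) a (x : tensor M A) :
  tensor_map h (a *: x) = h a *: tensor_map h x.
Proof.
elim/tensor_ind: x => s; rewrite [a *: _]tensor_scaleE !tensor_mapE.
rewrite [RHS]tensor_scaleE -!map_comp; congr tensor_pi.
by apply: eq_map => -[m b] /=; rewrite rmorphM.
Qed.

Definition qcoh_fun : sfunctor R :=
  @SFunctor R (fun A => tensor M A) tensor_map tensor_map_id tensor_map_comp.

Definition qcoh : rmodule R :=
  RModule qcoh_fun
    (@ModuleOn R qcoh_fun (fun=> 0) (fun _ x => - x) (fun _ x y => x + y)
       (fun _ a x => a *: x) (fun A => @addrA (tensor M A))
       (fun A => @addrC (tensor M A)) (fun A => @add0r (tensor M A))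
       (fun A => @addNr (tensor M A)) (fun A => @scalerA A (tensor M A))
       (fun A => @scale1r A (tensor M A)) (fun A => @scalerDr A (tensor M A))
       (fun A a b x => @scalerDl A (tensor M A) x a b)
       tensor_mapD tensor_mapZ).

End QCoh.

Record directed (I : Type) (le : I -> I -> Prop) : Prop := Directed {
  dir_inhabited : inhabited I;
  dir_refl : forall i, le i i;
  dir_trans : forall i j k, le i j -> le j k -> le i k;
  dir_ub : forall i j, exists k, le i k /\ le j k }.

(* For a directed system of modules, the limit is the quotient of the
   disjoint union of the F i which identifies x in F i with y in F j when
   they have the same image in some F k; [limit_cocone] says that the map
   from this quotient to X is well defined and bijective. *)
Record limit_cocone (I : Type) (le : I -> I -> Prop) (F : I -> Type)
    (tr : forall i j, le i j -> F i -> F j) (X : Type)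
    (phi : forall i, F i -> X) : Prop := LimitCocone {
  lc_compat : forall i j (ij : le i j) x, phi j (tr i j ij x) = phi i x;
  lc_surj : forall x, exists i (y : F i), phi i y = x;
  lc_inj : forall i j (x : F i) (y : F j), phi i x = phi j y ->
    exists k (ik : le i k) (jk : le j k), tr i k ik x = tr j k jk y }.

Section DirectLimit.
Variables (R : comPzRingType) (I : Type) (le : I -> I -> Prop).

Record lmod_system (L : I -> lmodType R)
    (tr : forall i j, le i j -> {linear L i -> L j}) : Prop := LmodSystem {
  ls_dir : directed le;
  ls_id : forall i (ii : le i i) x, tr i i ii x = x;
  ls_comp : forall i j k (ij : le i j) (jk : le j k) (ik : le i k) x,
    tr j k jk (tr i j ij x) = tr i k ik x }.

Definition lmod_dirlim (L : I -> lmodType R)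
    (tr : forall i j, le i j -> {linear L i -> L j})
    (M : lmodType R) (phi : forall i, {linear L i -> M}) : Prop :=
  lmod_system tr /\ limit_cocone (fun i j ij => tr i j ij : L i -> L j) phi.

Record rmod_system (F : I -> rmodule R)
    (tr : forall i j, le i j -> rmor (F i) (F j)) : Prop := RmodSystem {
  rs_dir : directed le;
  rs_id : forall i (ii : le i i) A x, tr i i ii A x = x;
  rs_comp : forall i j k (ij : le i j) (jk : le j k) (ik : le i k) A x,
    tr j k jk A (tr i j ij A x) = tr i k ik A x }.

Definition rmod_dirlim (F : I -> rmodule R)
    (tr : forall i j, le i j -> rmor (F i) (F j))
    (G : rmodule R) (phi : forall i, rmor (F i) G) : Prop :=
  rmod_system tr /\
  forall A : calg R, limit_cocone (fun i j ij => tr i j ij A : F i A -> F j A)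
    (fun i => phi i A).

End DirectLimit.

(* The submodules S of F such that P S form a directed set under inclusion,
   and F is their direct limit. *)
Definition dirlim_of_submodules (R : comPzRingType) (F : rmodule R)
    (P : rmodule R -> Prop) : Prop :=
  let I := {S : submodule F | P (sub_mod S)} in
  @rmod_dirlim R I (fun S T => sub_le (sval S) (sval T))
    (fun S => sub_mod (sval S)) (fun S T ST => sub_le_mor ST)
    F (fun S => sub_incl (sval S)).

Definition free_finite_rank (R : comPzRingType) (L : lmodType R) : Prop :=
  exists (n : nat) (f : {linear L -> 'rV[R]_n}), bijective f.

Definition in_dual_image (R : comPzRingType) (L L' : lmodType R)
    (t : {linear L -> L'}) (w : {scalar L}) : Prop :=
  exists u : {scalar L'}, forall x, u (t x) = w x.

Definition dual_mittag_leffler (R : comPzRingType) (I : Type)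
    (le : I -> I -> Prop) (L : I -> lmodType R)
    (tr : forall i j, le i j -> {linear L i -> L j}) : Prop :=
  forall i, exists j (ij : le i j), forall k (jk : le j k) (ik : le i k),
    forall w : {scalar L i},
      in_dual_image (tr i k ik) w <-> in_dual_image (tr i j ij) w.

Definition flat_mittag_leffler (R : comPzRingType) (M : lmodType R) : Prop :=
  exists (I : Type) (le : I -> I -> Prop) (L : I -> lmodType R)
    (tr : forall i j, le i j -> {linear L i -> L j})
    (phi : forall i, {linear L i -> M}),
    [/\ lmod_dirlim tr phi, forall i, free_finite_rank (L i) &
        dual_mittag_leffler tr].

Definition dual_qcoh (R : comPzRingType) (N : lmodType R) : rmodule R :=
  dual (qcoh N).

Definition dirlim_of_dual_monos (R : comPzRingType) (G : rmodule R) : Prop :=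
  exists (I : Type) (le : I -> I -> Prop) (N : I -> lmodType R)
    (tr : forall i j, le i j -> rmor (dual_qcoh (N i)) (dual_qcoh (N j)))
    (phi : forall i, rmor (dual_qcoh (N i)) G),
    rmod_dirlim tr phi /\ forall i j (ij : le i j), rmono (tr i j ij).

(* As a module scheme, W^* is affine: it is represented by the symmetric
   algebra of W. *)
Definition factors_through_dual_sub (R : comPzRingType) (F G : rmodule R)
    (f : rmor F G) : Prop :=
  exists (W : lmodType R) (S : submodule G),
    [/\ affine_mod (sub_mod S), risomorphic (sub_mod S) (dual_qcoh W) &
      exists g : rmor F (sub_mod S), f = rmor_comp (sub_incl S) g].

(* Main.v *)
(* All conditions are equivalent to the following one: every finite family x in
   M can be written x = P y, with y a finite family in M and P a matrix over R,
   in such a way that for every R-algebra A and every vector a over A,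
   sum_k x_k (x) a_k = 0 in M (x) A implies a P = 0.
   - For M the limit of free modules L_i with the Mittag-Leffler condition, lift
     x to some L_i and take P to be the matrix of the image of the lift in L_j,
     with j as in the condition. Conversely such factorizations are the indices
     of a direct system, with y spanned by the next x.
   - If the solutions b of sum_k x_k (x) b_k = 0 are represented by an algebra A
     and a generic solution kappa in A^n, they are stable under R-linear maps,
     so (0, kappa) is a solution over the square-zero algebra R (+) A, and it
     gives an R-linear projection of A onto the span of kappa; this shows that
     x = P y with kappa P = 0. This covers the kernels of (4) and (5), and it
     covers (2) because the kernel of a map from R^n to an affine module scheme
     is affine.
   - A morphism N^* -> M is an element of M (x) N, so a monomorphism W^* -> M
     whose image contains x gives P. Conversely the condition gives
     submodules W^* of M containing any given finite family, and the kernel of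
     N^* -> M is the dual of a quotient of N. *)
From HB Require Import structures.
Require Import Defs.
From mathcomp Require Import all_boot all_order all_algebra.
From mathcomp Require Import boolp.

Set Implicit Arguments.
Unset Strict Implicit.
Unset Printing Implicit Defensive.

Import GRing.Theory.
Local Open Scope ring_scope.
Local Open Scope quotient_scope.

(** * Bundling functions as linear, additive and ring morphisms *)

Definition linear_of (R : pzRingType) (U V : lmodType R) (f : U -> V)
    (fP : linear f) : {linear U -> V} :=
  HB.pack f (GRing.isLinear.Build R U V *:%R f fP).

Definition scalar_of (R : pzRingType) (U : lmodType R) (f : U -> R)
    (fP : scalar f) : {scalar U} :=
  HB.pack f (GRing.isLinear.Build R U R *%R f fP).

(** The structure also asks for [f 0 = 0], obtained by cancelling [f 0] in [f 0 + f 0 = f 0]. *)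
Definition additive_of (U V : zmodType) (f : U -> V)
    (fD : {morph f : x y / x + y}) : {additive U -> V} :=
  HB.pack f (GRing.isNmodMorphism.Build U V f
    (conj (addrI (f 0) (etrans (esym (fD 0 0))
       (etrans (congr1 f (addr0 0)) (esym (addr0 (f 0)))))) fD)).

Section RMorphismOf.
Variables (A B : pzRingType) (f : A -> B).
Hypotheses (fD : {morph f : x y / x + y}) (f1 : f 1 = 1).
Hypothesis fM : {morph f : x y / x * y}.

Definition rmorphism_of : {rmorphism A -> B} :=
  HB.pack f (GRing.Additive.class (additive_of fD))
    (GRing.isMonoidMorphism.Build A B f (conj f1 fM)).
End RMorphismOf.

(** * Quotients and square-zero extensions *)

Section Quotient.
Variables (R : pzRingType) (V : lmodType R) (P : V -> Prop).

Record submod_prop : Prop := SubmodProp {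
  submod0 : P 0;
  submodD : forall x y, P x -> P y -> P (x + y);
  submodZ : forall a x, P x -> P (a *: x) }.

Hypothesis subP : submod_prop.

Lemma submodN x : P x -> P (- x).
Proof. by rewrite -scaleN1r; apply: submodZ. Qed.

Definition quot_relb (x y : V) : bool := `[< P (x - y) >].

Lemma quot_relb_refl : reflexive quot_relb.
Proof. by move=> x; apply/asboolP; rewrite subrr; apply: submod0. Qed.
Lemma quot_relb_sym : symmetric quot_relb.
Proof.
by move=> x y; apply/asboolP/asboolP => /submodN; rewrite opprB.
Qed.
Lemma quot_relb_trans : transitive quot_relb.
Proof.
move=> y x z /asboolP xy /asboolP yz; apply/asboolP.
by rewrite -[x - z](subrKA y); apply: submodD.
Qed.

Definition quot_equiv :=
  EquivRel quot_relb quot_relb_refl quot_relb_sym quot_relb_trans.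

Definition quot_mod := {eq_quot quot_equiv}.
HB.instance Definition _ := Choice.on quot_mod.

Definition quot_pi (x : V) : quot_mod := \pi_({eq_quot quot_equiv}) x.

Lemma quot_piP x y : quot_pi x = quot_pi y <-> P (x - y).
Proof.
split=> [/eqmodP /asboolP //|xy]; by apply/eqmodP/asboolP.
Qed.

Lemma quot_repr x : P (repr (quot_pi x) - x).
Proof. by apply/quot_piP; rewrite /quot_pi reprK. Qed.

Lemma quot_ind (Q : quot_mod -> Prop) :
  (forall x, Q (quot_pi x)) -> forall x, Q x.
Proof. by move=> Qpi x; rewrite -[x]reprK; apply: Qpi. Qed.

Definition quot_add (x y : quot_mod) := quot_pi (repr x + repr y).
Definition quot_scale (a : R) (x : quot_mod) := quot_pi (a *: repr x).
Definition quot_opp (x : quot_mod) := quot_scale (-1) x.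

Lemma quot_addE x y : quot_add (quot_pi x) (quot_pi y) = quot_pi (x + y).
Proof.
by apply/quot_piP; rewrite opprD addrACA; apply: submodD => //;
  apply: quot_repr.
Qed.

Lemma quot_scaleE a x : quot_scale a (quot_pi x) = quot_pi (a *: x).
Proof.
by apply/quot_piP; rewrite -scalerBr; apply: submodZ => //; apply: quot_repr.
Qed.

Lemma quot_addA : associative quot_add.
Proof.
elim/quot_ind=> x; elim/quot_ind=> y; elim/quot_ind=> z.
by rewrite !quot_addE addrA.
Qed.
Lemma quot_addC : commutative quot_add.
Proof.
by elim/quot_ind=> x; elim/quot_ind=> y; rewrite !quot_addE addrC.
Qed.
Lemma quot_add0 : left_id (quot_pi 0) quot_add.
Proof. by elim/quot_ind=> x; rewrite quot_addE add0r. Qed.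
Lemma quot_addN : left_inverse (quot_pi 0) quot_opp quot_add.
Proof.
by elim/quot_ind=> x; rewrite /quot_opp quot_scaleE quot_addE scaleN1r addNr.
Qed.

HB.instance Definition _ := GRing.isZmodule.Build quot_mod
  quot_addA quot_addC quot_add0 quot_addN.

Lemma quot_scaleA a b x : quot_scale a (quot_scale b x) = quot_scale (a * b) x.
Proof. by elim/quot_ind: x => x; rewrite !quot_scaleE scalerA. Qed.
Lemma quot_scale1 : left_id 1 quot_scale.
Proof. by elim/quot_ind=> x; rewrite quot_scaleE scale1r. Qed.
Lemma quot_scaleDr : right_distributive quot_scale +%R.
Proof.
move=> a; elim/quot_ind=> x; elim/quot_ind=> y.
by rewrite [_ + _]quot_addE !quot_scaleE [RHS]quot_addE scalerDr.
Qed.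
Lemma quot_scaleDl x : {morph quot_scale^~ x : a b / a + b}.
Proof.
elim/quot_ind: x => x a b.
by rewrite !quot_scaleE [RHS]quot_addE scalerDl.
Qed.

HB.instance Definition _ := GRing.Zmodule_isLmodule.Build R quot_mod
  quot_scaleA quot_scale1 quot_scaleDr quot_scaleDl.

Lemma quot_pi_linear : linear quot_pi.
Proof.
move=> a x y; symmetry.
by rewrite [a *: _]quot_scaleE [_ + _]quot_addE.
Qed.
HB.instance Definition _ :=
  GRing.isLinear.Build R V quot_mod *:%R quot_pi quot_pi_linear.

Lemma quot_pi0P x : quot_pi x = 0 <-> P x.
Proof. by rewrite -[0](linear0 quot_pi) quot_piP subr0. Qed.

Section QuotLift.
Variables (W : lmodType R) (f : {linear V -> W}).
Hypothesis f0 : forall x, P x -> f x = 0.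

Definition quot_lift_fun (x : quot_mod) : W := f (repr x).

Lemma quot_lift_funE x : quot_lift_fun (quot_pi x) = f x.
Proof. by apply/eqP; rewrite -subr_eq0 -linearB f0 //; apply: quot_repr. Qed.

Lemma quot_lift_linear : linear quot_lift_fun.
Proof.
move=> a; elim/quot_ind=> x; elim/quot_ind=> y.
by rewrite -linearP !quot_lift_funE linearP.
Qed.

Definition quot_lift : {linear quot_mod -> W} := linear_of quot_lift_linear.

Lemma quot_liftE x : quot_lift (quot_pi x) = f x.
Proof. exact: quot_lift_funE. Qed.
End QuotLift.

End Quotient.

Section SquareZero.
Variables (A : comPzRingType) (N : lmodType A).

(** The ring $A\oplus N$ in which $N$ is an ideal of square zero. Algebra morphisms to and from such
    rings carry linear maps, which is how functors on algebras detect them. *)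
Definition sqz_ring := (A * N)%type.
HB.instance Definition _ := GRing.Zmodule.on sqz_ring.

Definition sqz_mul (x y : sqz_ring) : sqz_ring :=
  (x.1 * y.1, x.1 *: y.2 + y.1 *: x.2).

Lemma sqz_mulA : associative sqz_mul.
Proof.
move=> [a x] [b y] [c z]; congr pair => /=; first exact: mulrA.
by rewrite !scalerDr !scalerA addrA [c * a]mulrC [c * b]mulrC.
Qed.
Lemma sqz_mulC : commutative sqz_mul.
Proof. by move=> [a x] [b y]; congr pair => /=; rewrite (mulrC, addrC). Qed.
Lemma sqz_mul1 : left_id ((1, 0) : sqz_ring) sqz_mul.
Proof.
by move=> [a x]; rewrite /sqz_mul /= mul1r scale1r scaler0 addr0.
Qed.
Lemma sqz_mulDl : left_distributive sqz_mul +%R.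
Proof.
move=> [a x] [b y] [c z]; congr pair => /=; first exact: mulrDl.
by rewrite scalerDl scalerDr addrACA.
Qed.

HB.instance Definition _ := GRing.Zmodule_isComPzRing.Build sqz_ring
  sqz_mulA sqz_mulC sqz_mul1 sqz_mulDl.

Definition sqz_inl (a : A) : sqz_ring := (a, 0).

Lemma sqz_inlD : {morph sqz_inl : a b / a + b}.
Proof. by move=> a b; congr pair; rewrite addr0. Qed.
Lemma sqz_inlM : {morph sqz_inl : a b / a * b}.
Proof. by move=> a b; congr pair; rewrite !scaler0 addr0. Qed.

Lemma sqz_inrD : {morph (fun n => (0, n) : sqz_ring) : m n / m + n}.
Proof. by move=> m n; congr pair; rewrite addr0. Qed.

Definition sqz_inl_rmor : {rmorphism A -> sqz_ring} :=
  rmorphism_of sqz_inlD erefl sqz_inlM.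
End SquareZero.

Definition sqz (R : comPzRingType) (A : calg R) (N : lmodType A) : calg R :=
  CAlg (sqz_ring N) (sqz_inl_rmor N \o calg_str A).

Definition sqz_unit (R : comPzRingType) (A : calg R) (N : lmodType A) :
    calg_hom A (sqz N) :=
  @CAlgHom R A (sqz N) (sqz_inl_rmor N) (fun=> erefl).

Definition calg_base (R : comPzRingType) : calg R := CAlg R idfun.

Section CAlgLmod.
Variables (R : comPzRingType) (A : calg R).

(** The alias carries the [R]-module structure given by [calg_str], so that [R]-linear maps between
    algebras that are not ring morphisms can be stated. *)
Definition calg_lmod : Type := A.
HB.instance Definition _ := GRing.Zmodule.on calg_lmod.
Definition calg_scale (r : R) (a : calg_lmod) : calg_lmod :=
  (calg_str A r * a : A).
Lemma calg_scaleA r s a :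
  calg_scale r (calg_scale s a) = calg_scale (r * s) a.
Proof. by rewrite /calg_scale mulrA rmorphM. Qed.
Lemma calg_scale1 : left_id 1 calg_scale.
Proof. by move=> a; rewrite /calg_scale rmorph1 mul1r. Qed.
Lemma calg_scaleDr : right_distributive calg_scale +%R.
Proof. by move=> r a b; rewrite /calg_scale mulrDr. Qed.
Lemma calg_scaleDl a : {morph calg_scale^~ a : r s / r + s}.
Proof. by move=> r s; rewrite /calg_scale rmorphD mulrDl. Qed.
HB.instance Definition _ := GRing.Zmodule_isLmodule.Build R calg_lmod
  calg_scaleA calg_scale1 calg_scaleDr calg_scaleDl.

Lemma calg_lmodZ (r : R) (a : calg_lmod) : r *: a = (calg_str A r * a : A).
Proof. by []. Qed.
End CAlgLmod.

(** * Tensor products *)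

Section TensorLift.
Variables (R : comPzRingType) (M : lmodType R) (A : calg R).

Lemma tmulDl (m m' : M) (a : A) : tmul (m + m') a = tmul m a + tmul m' a.
Proof. by rewrite [RHS]tensor_addE; apply/tensor_piP/TensorDl. Qed.
Lemma tmulDr (m : M) (a a' : A) : tmul m (a + a') = tmul m a + tmul m a'.
Proof. by rewrite [RHS]tensor_addE; apply/tensor_piP/TensorDr. Qed.
Lemma tmulZ r (m : M) (a : A) : tmul (r *: m) a = tmul m (calg_str A r * a).
Proof. exact/tensor_piP/TensorZ. Qed.
Lemma tmulZr (m : M) (a b : A) : tmul m (b * a) = b *: tmul m a.
Proof. by rewrite [RHS]tensor_scaleE. Qed.

Lemma tmul_addl (a : A) : {morph (fun m : M => tmul m a) : m m' / m + m'}.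
Proof. by move=> m m'; rewrite tmulDl. Qed.
Lemma tmul_addr (m : M) : {morph (fun a : A => tmul m a) : a a' / a + a'}.
Proof. by move=> a a'; rewrite tmulDr. Qed.

Lemma tmul0r (m : M) : tmul m (0 : A) = 0.
Proof. exact: (raddf0 (additive_of (tmul_addr m))). Qed.
Lemma tmul_suml I (r : seq I) (F : I -> M) (a : A) :
  tmul (\sum_(i <- r) F i) a = \sum_(i <- r) tmul (F i) a.
Proof. exact: (raddf_sum (additive_of (tmul_addl a))). Qed.
Lemma tmul_sumr I (r : seq I) (F : I -> A) (m : M) :
  tmul m (\sum_(i <- r) F i) = \sum_(i <- r) tmul m (F i).
Proof. exact: (raddf_sum (additive_of (tmul_addr m))). Qed.

Lemma tensor_pi_sum (s : seq (M * A)) :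
  tensor_pi s = \sum_(p <- s) tmul p.1 p.2.
Proof.
elim: s => [|[m a] s IHs]; first by rewrite big_nil.
by rewrite big_cons -IHs [RHS]tensor_addE.
Qed.

Lemma tensor_sumP (x : tensor M A) :
  exists n (m : 'I_n -> M) (a : 'I_n -> A), x = \sum_k tmul (m k) (a k).
Proof.
elim/tensor_ind: x => s.
exists (size s), (fun k => (tnth (in_tuple s) k).1),
  (fun k => (tnth (in_tuple s) k).2).
by rewrite tensor_pi_sum (big_tnth _ _ s).
Qed.

Lemma tensor_scale_sum k (m : 'I_k -> M) (a : 'I_k -> A) (b : A) :
  b *: (\sum_i tmul (m i) (a i)) = \sum_i tmul (m i) (b * a i).
Proof. by rewrite scaler_sumr; apply: eq_bigr => i _; rewrite tmulZr. Qed.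

Section Lift.
Variables (V : zmodType) (f : M -> A -> V).
Hypothesis fDl : forall m m' a, f (m + m') a = f m a + f m' a.
Hypothesis fDr : forall m a a', f m (a + a') = f m a + f m a'.
Hypothesis fZ : forall r m a, f (r *: m) a = f m (calg_str A r * a).

Definition tensor_lift_fun (x : tensor M A) : V :=
  \sum_(p <- repr x) f p.1 p.2.

Lemma tensor_rel_sum s t : tensor_rel s t ->
  \sum_(p <- s) f p.1 p.2 = \sum_(p <- t) f p.1 p.2 :> V.
Proof.
elim=> {s t} //.
- by move=> s t u _ -> _ ->.
- by move=> s s' t t' _ ss' _ tt'; rewrite !big_cat /= ss' tt'.
- by move=> s t; rewrite !big_cat /= addrC.
- by move=> m m' a; rewrite !big_cons !big_nil /= addr0 fDl addr0.
- by move=> m a a'; rewrite !big_cons !big_nil /= addr0 fDr addr0.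
- by move=> r m a; rewrite !big_cons !big_nil /= fZ.
- move=> a; rewrite big_cons !big_nil /= addr0.
  (* Additivity gives [f 0 a + f 0 a = f 0 a], whence [f 0 a = 0]. *)
  by apply: (addrI (f 0 a)); rewrite -fDl !addr0.
Qed.

Lemma tensor_lift_pi s : tensor_lift_fun (tensor_pi s) = \sum_(p <- s) f p.1
  p.2.
Proof. exact/tensor_rel_sum/tensor_repr. Qed.

Lemma tensor_lift_add : {morph tensor_lift_fun : x y / x + y}.
Proof.
elim/tensor_ind=> s; elim/tensor_ind=> t.
by rewrite [_ s + _]tensor_addE !tensor_lift_pi big_cat.
Qed.

(** The universal property for balanced biadditive maps. The target is only an abelian group, so
    that maps which are not [A]-linear are covered. *)
Definition tensor_lift : {additive tensor M A -> V} :=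
  additive_of tensor_lift_add.

Lemma tensor_lift_tmul m a : tensor_lift (tmul m a) = f m a.
Proof.
by rewrite [LHS]tensor_lift_pi big_cons big_nil addr0.
Qed.

End Lift.

End TensorLift.

Section TensorFunctor.
Variables (R : comPzRingType) (M M' : lmodType R) (A : calg R).

Section Mapl.
Variable g : {linear M -> M'}.
Definition tensor_mapl : {additive tensor M A -> tensor M' A}.
Proof.
refine (@tensor_lift R M A _ (fun m a => tmul (g m) a) _ _ _).
- by move=> m m' a; rewrite linearD tmulDl.
- by move=> m a a'; rewrite tmulDr.
- by move=> r m a; rewrite linearZ tmulZ.
Defined.

Lemma tensor_mapl_tmul m a : tensor_mapl (tmul m a) = tmul (g m) a.
Proof. exact: tensor_lift_tmul. Qed.
End Mapl.

Section Contract.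
Variable u : {scalar M}.
Definition tensor_contract : {additive tensor M A -> A}.
Proof.
refine (@tensor_lift R M A _ (fun m a => a * calg_str A (u m)) _ _ _).
- by move=> m m' a; rewrite linearD rmorphD mulrDr.
- by move=> m a a'; rewrite mulrDl.
- by move=> r m a; rewrite linearZ rmorphM mulrCA mulrA.
Defined.

Lemma tensor_contract_tmul m a :
  tensor_contract (tmul m a) = a * calg_str A (u m).
Proof. exact: tensor_lift_tmul. Qed.
End Contract.
End TensorFunctor.

Section TensorMaps.
Variables (R : comPzRingType) (M : lmodType R).

Lemma smap_tmul (A B : calg R) (h : calg_hom A B) (m : M) (a : A) :
  smap (s := qcoh M) h (tmul m a) = tmul m (h a).
Proof. exact: tensor_mapE. Qed.

Lemma smap_qcoh_sum (A B : calg R) (h : calg_hom A B) I (r : seq I)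
    (F : I -> tensor M A) :
  smap (s := qcoh M) h (\sum_(i <- r) F i) =
  \sum_(i <- r) (smap (s := qcoh M) h (F i) : tensor M B).
Proof.
exact: (raddf_sum (additive_of (@tensor_mapD R M A B h))).
Qed.

Section TensorLin.
Variables (A B : calg R) (u : {linear calg_lmod A -> calg_lmod B}).

(** While [smap] transports tensors along algebra morphisms, this transports them along [R]-linear
    maps; solutions of $\sum_k x_k\otimes b_k=0$ are therefore stable under such maps. *)
Definition tensor_lin : {additive tensor M A -> tensor M B}.
Proof.
refine (@tensor_lift R M A _ (fun m a => tmul m (u a : B)) _ _ _).
- by move=> m m' a; apply: tmulDl.
- by move=> m a a'; rewrite (linearD u) tmulDr.
- by move=> r m a; rewrite tmulZ; congr tmul; symmetry;
  exact: (linearZ_LR u r a).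
Defined.

Lemma tensor_lin_tmul m a : tensor_lin (tmul m a) = tmul m (u a : B).
Proof. exact: tensor_lift_tmul. Qed.
End TensorLin.

(** One direction of $M\otimes_R R\cong M$, used to read an equation between tensors over [R] as an
    equation in [M]. *)
Definition tensor_base : {additive tensor M (calg_base R) -> M}.
Proof.
refine (@tensor_lift R M (calg_base R) _ (fun m (a : R) => a *: m) _ _ _).
- by move=> m m' a; apply: scalerDr.
- by move=> m a a'; apply: scalerDl.
- by move=> r m a; rewrite scalerA mulrC.
Defined.

Lemma tensor_base_tmul m a : tensor_base (tmul m a) = (a : R) *: m.
Proof. exact: tensor_lift_tmul. Qed.


End TensorMaps.

(** * Points of N^* *)

Section DualQcoh.
Variables (R : comPzRingType) (N : lmodType R).

(** The linear map $N\to A$ attached to a point of $N^*(A)$; with its inverse [dmk] it gives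
    $N^*(A)=\mathrm{Hom}_R(N,A)$. *)
Definition dev (A : calg R) (w : dual_qcoh N A) (n : N) : A :=
  rmor_fun w (calg_self A) (tmul n 1 : tensor N (calg_restr (calg_self A))).

Section OneAlgebra.
Variable A : calg R.

(** Naturality along the structure morphism $A\to B$ reduces the claim to $n\otimes 1$ over $A$, and
    linearity over $B$ takes [b] out. *)
Lemma dualE (w : dual_qcoh N A) (B : calg A) (n : N) (b : calg_restr B) :
  rmor_fun w B (tmul n b) = (b * calg_str B (dev w n) : B).
Proof.
pose h : calg_hom (calg_self A) B :=
  @CAlgHom A (calg_self A) B (calg_str B) (fun=> erefl).
pose n1 : tensor N (calg_restr (calg_self A)) := tmul n 1.
have -> : calg_str B (dev w n) = rmor_fun w B (smap h (n1 : restr_mod (qcoh N)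
  A _)).
  by rewrite (rmor_nat w h).
rewrite -[RHS](rmorZ w b); congr (rmor_fun w B _).
rewrite /= [tensor_map _ _](smap_tmul (calg_restr_hom h)) /= rmorph1.
rewrite -[in LHS](mulr1 b); exact: tmulZr.
Qed.

Lemma dual_sum (w : dual_qcoh N A) (B : calg A) k (n : 'I_k -> N)
    (b : 'I_k -> calg_restr B) :
  rmor_fun w B (\sum_i tmul (n i) (b i)) =
  (\sum_i (b i * calg_str B (dev w (n i))) : B).
Proof.
have wD : {morph rmor_fun w B : x y / (x + y : tensor N (calg_restr B)) >->
    (x + y : B)} by move=> x y; exact: (rmorD w).
apply: etrans (raddf_sum (additive_of wD) _ _ _) _.
by apply: eq_bigr => i _; apply: dualE.
Qed.

Lemma dev_linear (w : dual_qcoh N A) : linear (dev w : N -> calg_lmod A).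
Proof.
move=> r n n'; rewrite /dev tmulDl [LHS](rmorD w) /= tmulZ mulr1.
by rewrite [X in radd X _]dualE.
Qed.

Definition dev_lin (w : dual_qcoh N A) := linear_of (@dev_linear w).

Lemma dev_inj (w w' : dual_qcoh N A) : dev w =1 dev w' -> w = w'.
Proof.
move=> ww'; apply: rmor_inj => B x.
have [k [n [b ->]]] := tensor_sumP x.
by rewrite !dual_sum; apply: eq_bigr => i _; rewrite ww'.
Qed.

Variable v : {linear N -> calg_lmod A}.

Definition dmk_at (B : calg A) : {additive tensor N (calg_restr B) -> B}.
Proof.
refine (@tensor_lift R N (calg_restr B) B
  (fun n b => b * calg_str B (v n)) _ _ _).
- by move=> m m' b; rewrite (linearD v) rmorphD mulrDr.
- by move=> m b b'; rewrite mulrDl.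
- by move=> r m b; rewrite linearZ_LR calg_lmodZ rmorphM mulrCA mulrA.
Defined.

Lemma dmk_at_tmul (B : calg A) n (b : calg_restr B) :
  dmk_at B (tmul n b) = (b * calg_str B (v n) : B).
Proof. exact: tensor_lift_tmul. Qed.

Definition dmk : dual_qcoh N A.
Proof.
refine (@RMor A (restr_mod (qcoh N) A) (struct_mod A) dmk_at _ _ _).
- move=> B C h x; have [k [n [b ->]]] := tensor_sumP x.
  rewrite [smap _ _](smap_qcoh_sum (calg_restr_hom h)) !raddf_sum
    [RHS]rmorph_sum.
  apply: eq_bigr => i _.
  by rewrite (smap_tmul (calg_restr_hom h)) !dmk_at_tmul rmorphM /= calg_homE.
- by move=> B x y; apply: raddfD.
- move=> B b x; have [k [n [b' ->]]] := tensor_sumP x.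
  apply: etrans (congr1 (dmk_at B) (tensor_scale_sum n b' b)) _.
  rewrite !raddf_sum [RHS]mulr_sumr; apply: eq_bigr => i _.
  by rewrite !dmk_at_tmul mulrA.
Defined.

Lemma dev_dmk n : dev dmk n = v n.
Proof. by rewrite /dev [LHS]dmk_at_tmul mul1r. Qed.
End OneAlgebra.

Lemma dev_map (A B : calg R) (h : calg_hom A B) (w : dual_qcoh N A) n :
  dev (smap h w) n = h (dev w n).
Proof.
rewrite /dev.
(* By definition of [dual_map], the image of [w] is evaluated by viewing [B] as an [A]-algebra
   through [h]; [dualE] then applies. *)
transitivity (rmor_fun w (calg_via h (calg_self B))
  (tmul n 1 : tensor N (calg_restr (calg_via h (calg_self B))))).
  exact: (congr1 (rmor_fun w (calg_via h (calg_self B)))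
    (smap_tmul (calg_via_iso h (calg_self B)) n 1)).
by rewrite dualE mul1r.
Qed.

Lemma dev_addr (A : calg R) (w : dual_qcoh N A) n n' :
  dev w (n + n') = dev w n + dev w n'.
Proof. exact: (linearD (dev_lin w)). Qed.
Lemma dev_scaler (A : calg R) (w : dual_qcoh N A) r n :
  dev w (r *: n) = calg_str A r * dev w n.
Proof. exact: (linearZ_LR (dev_lin w)). Qed.
Lemma dev_0r (A : calg R) (w : dual_qcoh N A) : dev w 0 = 0.
Proof. exact: (linear0 (dev_lin w)). Qed.
Lemma dev_sumr (A : calg R) (w : dual_qcoh N A) I (s : seq I) (F : I -> N) :
  dev w (\sum_(i <- s) F i) = \sum_(i <- s) dev w (F i).
Proof. exact: (linear_sum (dev_lin w)). Qed.

Lemma devD (A : calg R) (w w' : dual_qcoh N A) n :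
  dev (radd w w') n = dev w n + dev w' n.
Proof. by []. Qed.
Lemma devZ (A : calg R) (a : A) (w : dual_qcoh N A) n :
  dev (rscale a w) n = a * dev w n.
Proof. by []. Qed.
Lemma dev0 (A : calg R) n : dev (@rzero R (dual_qcoh N) A) n = 0.
Proof. by []. Qed.
End DualQcoh.

Section Pull.
Variables (R : comPzRingType) (N N' : lmodType R) (g : {linear N -> N'}).

Lemma pull_at_linear (A : calg R) (w : dual_qcoh N' A) :
  linear (dev_lin w \o g : N -> calg_lmod A).
Proof. by move=> r x y; rewrite /= (linearP g); apply: dev_linear. Qed.

Definition pull : rmor (dual_qcoh N') (dual_qcoh N).
Proof.
refine (@RMor R (dual_qcoh N') (dual_qcoh N)
  (fun A w => dmk (linear_of (pull_at_linear w))) _ _ _).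
- by move=> A B h w; apply: dev_inj => n; rewrite dev_map !dev_dmk;
  apply: dev_map.
- by move=> A w w'; apply: dev_inj => n; rewrite devD !dev_dmk.
- by move=> A a w; apply: dev_inj => n; rewrite devZ !dev_dmk.
Defined.

Lemma dev_pull A (w : dual_qcoh N' A) n : dev (pull A w) n = dev w (g n).
Proof. by rewrite dev_dmk. Qed.
End Pull.

Section Pairing.
Variables (R : comPzRingType) (M N : lmodType R).
Variables (k : nat) (x : 'I_k -> M) (y : 'I_k -> N).

(* The element sum_i x_i (x) y_i of M (x) N, as a morphism N^* -> M. *)
Definition pairing : rmor (dual_qcoh N) (qcoh M).
Proof.
refine (@RMor R (dual_qcoh N) (qcoh M)
  (fun A w => (\sum_i tmul (x i) (dev w (y i)) : tensor M A)) _ _ _).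
- move=> A B h w; rewrite smap_qcoh_sum; apply: eq_bigr => i _.
  by rewrite dev_map smap_tmul.
- move=> A w w'; rewrite /radd /= -big_split; apply: eq_bigr => i _.
  exact: tmulDr.
- move=> A a w; exact: (esym (tensor_scale_sum _ _ _)).
Defined.

Lemma pairingE A (w : dual_qcoh N A) :
  pairing A w = (\sum_i tmul (x i) (dev w (y i)) : tensor M A).
Proof. by []. Qed.
End Pairing.

(** * Isomorphisms and reflexivity *)

Section Iso.
Variable R : comPzRingType.

(** The inverse is chosen pointwise; injectivity of [f] forces the choices to be natural and
    linear. *)
Lemma bij_riso (F G : rmodule R) (f : rmor F G) :
  (forall A, injective (f A)) -> (forall A y, exists x, f A x = y) -> is_riso f.
Proof.
move=> f_inj f_surj.
pose g A y := sval (cid (f_surj A y)).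
have gK A y : f A (g A y) = y := svalP (cid (f_surj A y)).
have @gm : rmor G F.
  refine (@RMor R G F g _ _ _).
  - by move=> A B h x; apply: f_inj; rewrite rmor_nat !gK.
  - by move=> A x y; apply: f_inj; rewrite rmorD !gK.
  - by move=> A a x; apply: f_inj; rewrite rmorZ !gK.
exists gm => A; split=> x; last exact: gK.
by apply: (f_inj A); apply: gK.
Qed.

Lemma riso_sym (F G : rmodule R) : risomorphic F G -> risomorphic G F.
Proof.
by move=> [f [g fg]]; exists g, f => A; case: (fg A).
Qed.

Lemma riso_trans (F G H : rmodule R) :
  risomorphic F G -> risomorphic G H -> risomorphic F H.
Proof.
move=> [f [f' ff']] [g [g' gg']]; exists (rmor_comp g f), (rmor_comp f' g').
move=> A; have [fK f'K] := ff' A; have [gK g'K] := gg' A.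
by split=> x /=; rewrite ?gK ?fK ?f'K ?g'K.
Qed.

Section DualMor.
Variables (F G : rmodule R) (f : rmor F G).

Definition dual_mor_at (A : calg R) (w : dual G A) : dual F A.
Proof.
refine (@RMor A (restr_mod F A) (struct_mod A)
  (fun B x => rmor_fun w B (f (calg_restr B) x)) _ _ _).
- by move=> B C h x; rewrite /= (rmor_nat f); apply: (rmor_nat w).
- by move=> B x y; rewrite [f _ _](rmorD f); apply: (rmorD w).
- by move=> B b x; rewrite [f _ _](rmorZ f); apply: (rmorZ w).
Defined.

Definition dual_mor : rmor (dual G) (dual F).
Proof.
refine (@RMor R (dual G) (dual F) dual_mor_at _ _ _).
- by move=> A B h w; apply: rmor_inj => C x; rewrite /= rmor_nat.
- by move=> A w w'; apply: rmor_inj.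
- by move=> A a w; apply: rmor_inj.
Defined.

Lemma dual_morE A (w : dual G A) (B : calg A) x :
  rmor_fun (dual_mor A w) B x = rmor_fun w B (f (calg_restr B) x).
Proof. by []. Qed.
End DualMor.

Lemma bidual_nat (F G : rmodule R) (f : rmor F G) A (x : F A) :
  dual_mor (dual_mor f) A (bidual F A x) = bidual G A (f A x).
Proof.
by apply: rmor_inj => B w; rewrite /= !(rmor_nat f).
Qed.

Lemma riso_reflexive (F G : rmodule R) :
  risomorphic F G -> reflexive_mod G -> reflexive_mod F.
Proof.
move=> [f [g fg]] [b bG]; apply: bij_riso => A.
  move=> x y xy; have [fK _] := fg A; have [bK _] := bG A.
  by apply: (can_inj fK); apply: (can_inj bK); rewrite -!bidual_nat xy.
(* The preimage of [X] is found by moving [X] to the bidual of [G], inverting [bidual G] there, and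
   returning to [F] by [g]. *)
move=> X; exists (g A (b A (dual_mor (dual_mor f) A X))).
have [_ gK] := fg A; have [_ bK] := bG A.
rewrite -bidual_nat bK; apply: rmor_inj => B w.
rewrite !dual_morE; congr (rmor_fun X B _); apply: rmor_inj => C x.
by rewrite !dual_morE; have [fK' _] := fg (calg_restr C); rewrite fK'.
Qed.

(** A triangle identity: [bidual (dual F)] followed by the dual of [bidual F] is the identity of
    [dual F]. *)
Lemma bidual_dual (F : rmodule R) A (w : dual F A) (B : calg A)
    (t : F (calg_restr B)) :
  rmor_fun (bidual (dual F) A w) B (bidual F (calg_restr B) t) =
  rmor_fun w B t.
Proof.
pose k : calg_hom B (calg_via (calg_unit B) (calg_via
    (calg_unit (calg_self (calg_restr B)))
    (calg_self (calg_restr (calg_self (calg_restr B)))))) :=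
  @CAlgHom A B (calg_via (calg_unit B) (calg_via
    (calg_unit (calg_self (calg_restr B)))
    (calg_self (calg_restr (calg_self (calg_restr B)))))) idfun (fun=> erefl).
rewrite /= -!smap_comp; have := rmor_nat w k t => /= <-.
by f_equal; apply: smap_eq.
Qed.

(** By [bidual_dual], the dual of [bidual F] is a left inverse of [bidual (dual F)]. It is also a
    right inverse, because a form on the bidual of [F] is determined by its values on the image of
    [bidual F]. *)
Lemma dual_reflexive (F : rmodule R) :
  (forall A Y, exists x, bidual F A x = Y) -> reflexive_mod (dual F).
Proof.
move=> F_surj; apply: bij_riso => A.
  move=> w w' ww'; apply: rmor_inj => B t.
  rewrite -[LHS](bidual_dual w t) ww'; exact: bidual_dual.
move=> Y; exists (dual_mor (bidual F) A Y); apply: rmor_inj => B X.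
have [t <-] := F_surj (calg_restr B) X.
exact: bidual_dual.
Qed.
End Iso.

(** * Dual numbers, morphisms $N^*\to M$, and reflexivity of $N^*$ *)

Definition dual_numbers (R : comPzRingType) (A : calg R) : calg R := sqz (A^o :
  lmodType A).
Definition eps {R : comPzRingType} {A : calg R} : dual_numbers A :=
  ((0 : A), (1 : A^o)).

Section EpsPart.
Variables (R : comPzRingType) (A : calg R).

Lemma eps_part_linear :
  linear (fun x : calg_lmod (dual_numbers A) => (x.2 : calg_lmod A)).
Proof.
by move=> r [a b] [a' b']; rewrite /= scaler0 addr0.
Qed.

Definition eps_part : {linear calg_lmod (dual_numbers A) -> calg_lmod A} :=
  linear_of eps_part_linear.

Lemma eps_partE (a : A) :
  eps_part (eps * sqz_unit (A^o : lmodType A) a) = a.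
Proof.
have -> : eps * sqz_unit (A^o : lmodType A) a = ((0 * a,
  0 *: 0 + a *: (1 : A^o)) : dual_numbers A) by [].
rewrite /eps_part /= scaler0 add0r; exact: mulr1.
Qed.

(** The coefficient of [eps] recovers a tensor over $A$ from its multiple by [eps], so equalities
    over $A[\epsilon]$ descend to $A$. *)
Lemma tensor_eps_part (M : lmodType R) (x : tensor M A) :
  tensor_lin M eps_part (eps *: (smap (s := qcoh M) (sqz_unit (A^o : lmodType
    A)) x : tensor M (dual_numbers A))) = x.
Proof.
have [n [m [a ->]]] := tensor_sumP x.
rewrite smap_qcoh_sum scaler_sumr raddf_sum; apply: eq_bigr => i _.
by rewrite smap_tmul -tmulZr tensor_lin_tmul eps_partE.
Qed.
End EpsPart.

Section FromDual.
Variables (R : comPzRingType) (M N : lmodType R).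

(* Hom(N^*, M) = M (x) N: the image of the inclusion N -> R (+) N, seen as a
   point of N^* over R (+) N, determines f(w) for every w, because the
   morphism r + n |-> r + w(n) eps from R (+) N to A[eps] sends this point to
   eps w. *)
Lemma from_dual_pairing (f : rmor (dual_qcoh N) (qcoh M)) :
  exists k (x : 'I_k -> M) (y : 'I_k -> N), f = pairing x y.
Proof.
pose E := sqz (A := calg_base R) N.
have vlin : linear ((fun n => (0, n)) : N -> calg_lmod E).
  move=> r n n'; rewrite calg_lmodZ /=.
  by congr pair; rewrite /= ?(mulr0, addr0, scaler0).
have [k [x [e eE]]] := tensor_sumP (f E (dmk (linear_of vlin))).
(* Only the $N$-components of the [e i] count: their $R$-components are sent to constants of
   $A[\epsilon]$, which have no coefficient of [eps]. *)
exists k, x, (fun i => (e i).2); apply: rmor_inj => A w.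
have h : exists h : calg_hom E (dual_numbers A),
    forall z, h z = (calg_str A z.1, dev w z.2).
  have hD : {morph (fun z : E => (calg_str A z.1, dev w z.2) : dual_numbers A) :
     z z' / z + z'}.
    by move=> z z'; congr pair; rewrite /= ?rmorphD // dev_addr.
  have hM : {morph (fun z : E => (calg_str A z.1, dev w z.2) : dual_numbers A) :
     z z' / z * z'}.
    move=> z z'; congr pair; rewrite /= ?rmorphM //.
    by rewrite dev_addr !dev_scaler.
  have h1 : (calg_str A (1 : E).1, dev w (1 : E).2) = (1 : dual_numbers A).
    by congr pair; rewrite /= ?rmorph1 // dev_0r.
  unshelve eexists (@CAlgHom R E (dual_numbers A) (rmorphism_of hD h1 hM) _).
    by move=> r; congr pair; rewrite /= dev_0r.
  by [].
have {h} [h hE] := h.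
have hw : smap h (dmk (linear_of vlin)) =
    rscale (F := dual_qcoh N) eps (smap (sqz_unit (A^o : lmodType A)) w).
  apply: dev_inj => n; rewrite devZ !dev_map dev_dmk hE /= rmorph0.
  congr pair; rewrite /= ?mul0r // scale0r add0r; symmetry; exact: mulr1.
have := rmor_nat f h (dmk (linear_of vlin)).
rewrite hw eE rmorZ rmor_nat smap_qcoh_sum => /(congr1 (tensor_lin M (eps_part
  A))).
rewrite tensor_eps_part raddf_sum pairingE => ->; apply: eq_bigr => i _.
by rewrite smap_tmul tensor_lin_tmul hE.
Qed.

Lemma bidual_qcohE (A : calg R) k (n : 'I_k -> N) (a : 'I_k -> A) (B : calg A)
    (w : dual_qcoh N (calg_restr B)) :
  rmor_fun (bidual (qcoh N) A (\sum_i tmul (n i) (a i) : tensor N A)) B w =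
  \sum_i (calg_str B (a i) * dev w (n i) : B).
Proof.
rewrite /= [tensor_map (calg_unit B) _]smap_qcoh_sum.
rewrite [tensor_map _ _]smap_qcoh_sum.
have nE i : smap (s := qcoh N) (calg_unit (calg_self (calg_restr B)))
  (smap (s := qcoh N) (calg_unit B) (tmul (n i) (a i))) =
  tmul (n i) (calg_str B (a i) : calg_restr (calg_self (calg_restr B))).
  by rewrite !smap_tmul.
apply: etrans (congr1 (rmor_fun w _) (eq_bigr _ (fun i _ => nE i))) _.
exact: dual_sum.
Qed.

(** The generic-point argument of [from_dual_pairing], relative to $A$. The point
    $n\mapsto(0,n\otimes 1)$ of $N^*$ over $A\oplus(N\otimes A)$ specializes to [eps] times [w] over
    $B[\epsilon]$, so the second component of the value of [F] at this point determines [F] and is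
    the required tensor. *)
Lemma bidual_qcoh_surj A (F : dual (dual_qcoh N) A) :
  exists t, bidual (qcoh N) A t = F.
Proof.
pose E := sqz (A := calg_self A) (tensor N A : lmodType A).
have vlin : linear ((fun n => (0, tmul n 1)) : N -> calg_lmod (calg_restr E)).
  move=> r n n'; rewrite calg_lmodZ /=.
  congr pair; rewrite /= ?(mulr0, addr0, scaler0) //.
  by rewrite tmulDl tmulZ tmulZr.
pose u : dual_qcoh N (calg_restr E) := dmk (linear_of vlin).
exists (rmor_fun F E u : E).2; apply: rmor_inj => B w.
pose D := dual_numbers (B : calg A).
pose l (n : N) (a : A) : B := calg_str B a * dev w n.
have [L LE] : exists L : {additive tensor N A -> B},
    forall n a, L (tmul n a) = calg_str B a * dev w n.
  unshelve eexists (@tensor_lift R N A B (l) _ _ _).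
  - by move=> n n' a; rewrite /l dev_addr mulrDr.
  - by move=> n a a'; rewrite /l rmorphD mulrDl.
  - by move=> r n a; rewrite /l dev_scaler rmorphM mulrCA mulrA.
  by move=> n a; rewrite tensor_lift_tmul.
have LZ a t : L (a *: t) = calg_str B a * L t.
  have [k [n [b ->]]] := tensor_sumP t.
  rewrite scaler_sumr !raddf_sum mulr_sumr; apply: eq_bigr => i _.
  by rewrite -tmulZr !LE rmorphM mulrA.
have [h hE] : exists h : calg_hom E D, forall z, h z = (calg_str B z.1, L z.2).
  have hD : {morph (fun z : E => (calg_str B z.1, L z.2) : D) :
     z z' / z + z'}.
    by move=> z z'; congr pair; rewrite /= ?rmorphD // raddfD.
  have hM : {morph (fun z : E => (calg_str B z.1, L z.2) : D) :
     z z' / z * z'}.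
    by move=> z z'; congr pair; rewrite /= ?rmorphM // raddfD !LZ.
  have h1 : (calg_str B (1 : E).1, L (1 : E).2) = (1 : D).
    by congr pair; rewrite /= ?rmorph1 // raddf0.
  unshelve eexists (@CAlgHom A E D (rmorphism_of hD h1 hM) _).
    by move=> r; congr pair; rewrite /= raddf0.
  by [].
have hu : smap (calg_restr_hom h) u = rscale (F := dual_qcoh N)
    (A := calg_restr D) eps
    (smap (calg_restr_hom (sqz_unit (B^o : lmodType B))) w).
  apply: dev_inj => n; rewrite devZ !dev_map dev_dmk [LHS]hE /= LE rmorph0.
  by congr pair; rewrite /= ?mul0r // scale0r add0r rmorph1 mul1r; symmetry;
    apply: mulr1.
have := rmor_nat F h u.
rewrite [smap _ _]hu [LHS](rmorZ F) [in LHS](rmor_nat F (sqz_unit (B^o :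
  lmodType B))).
move=> /(congr1 snd) Ft.
have <- : L (rmor_fun F E u : E).2 = rmor_fun F B w.
  transitivity ((h (rmor_fun F E u)).2 : B); first by rewrite hE.
  by rewrite -[LHS]Ft /= scale0r add0r; apply: mulr1.
have [k [n [a ->]]] := tensor_sumP (rmor_fun F E u : E).2.
rewrite raddf_sum bidual_qcohE; apply: eq_bigr => i _; exact: esym (LE _ _).
Qed.

Lemma dual_qcoh_reflexive : reflexive_mod (dual_qcoh N).
Proof. exact: dual_reflexive bidual_qcoh_surj. Qed.
End FromDual.

(** * Representability *)

(** Polynomial expressions with coefficients in [R]. The variables form an arbitrary type, so that
    all elements of a module can serve as generators. *)
Inductive alg_term (R G : Type) : Type :=
| AVar of G
| AConst of R
| AAdd of alg_term R G & alg_term R G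
| AMul of alg_term R G & alg_term R G.
Arguments AVar {R G}.
Arguments AConst {R G}.

HB.instance Definition _ (R G : Type) := gen_eqMixin (alg_term R G).
HB.instance Definition _ (R G : Type) := gen_choiceMixin (alg_term R G).

Section PresentedAlgebra.
Variables (R : comPzRingType) (G : Type).
Local Notation term := (alg_term R G).
Variable rel : term -> term -> Prop.

Fixpoint alg_eval (A : calg R) (v : G -> A) (t : term) : A :=
  match t with
  | AVar g => v g
  | AConst r => calg_str A r
  | AAdd s t => alg_eval v s + alg_eval v t
  | AMul s t => alg_eval v s * alg_eval v t
  end.

Lemma alg_eval_map (A B : calg R) (h : calg_hom A B) (v : G -> A) t :
  h (alg_eval v t) = alg_eval (h \o v) t.
Proof.
by elim: t => //= [r|s <- t <-|s <- t <-];
  rewrite ?calg_homE ?rmorphD ?rmorphM.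
Qed.

(** The least congruence that contains [rel] and the laws of commutative [R]-algebras. The opposite
    of a term is its product with the constant $-1$. *)
Inductive pres_rel : term -> term -> Prop :=
| PresRel s t : rel s t -> pres_rel s t
| PresRefl s : pres_rel s s
| PresSym s t : pres_rel s t -> pres_rel t s
| PresTrans s t u : pres_rel s t -> pres_rel t u -> pres_rel s u
| PresAdd s s' t t' : pres_rel s s' -> pres_rel t t' ->
    pres_rel (AAdd s t) (AAdd s' t')
| PresMul s s' t t' : pres_rel s s' -> pres_rel t t' ->
    pres_rel (AMul s t) (AMul s' t')
| PresAddA s t u : pres_rel (AAdd s (AAdd t u)) (AAdd (AAdd s t) u)
| PresAddC s t : pres_rel (AAdd s t) (AAdd t s)
| PresAdd0 s : pres_rel (AAdd (AConst 0) s) s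
| PresAddN s : pres_rel (AAdd (AMul (AConst (-1)) s) s) (AConst 0)
| PresMulA s t u : pres_rel (AMul s (AMul t u)) (AMul (AMul s t) u)
| PresMulC s t : pres_rel (AMul s t) (AMul t s)
| PresMul1 s : pres_rel (AMul (AConst 1) s) s
| PresMulDl s t u : pres_rel (AMul (AAdd s t) u) (AAdd (AMul s u) (AMul t u))
| PresConstD r r' : pres_rel (AConst (r + r')) (AAdd (AConst r) (AConst r'))
| PresConstM r r' : pres_rel (AConst (r * r')) (AMul (AConst r) (AConst r')).

Lemma pres_rel_eval (A : calg R) (v : G -> A) :
  (forall s t, rel s t -> alg_eval v s = alg_eval v t) ->
  forall s t, pres_rel s t -> alg_eval v s = alg_eval v t.
Proof.
move=> vrel s t; elim=> {s t} //=.
- by move=> s t u _ -> _ ->.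
- by move=> s s' t t' _ -> _ ->.
- by move=> s s' t t' _ -> _ ->.
- by move=> s t u; rewrite addrA.
- by move=> s t; rewrite addrC.
- by move=> s; rewrite rmorph0 add0r.
- by move=> s; rewrite rmorphN rmorph1 rmorph0 mulN1r addNr.
- by move=> s t u; rewrite mulrA.
- by move=> s t; rewrite mulrC.
- by move=> s; rewrite rmorph1 mul1r.
- by move=> s t u; rewrite mulrDl.
- by move=> r r'; rewrite rmorphD.
- by move=> r r'; rewrite rmorphM.
Qed.

Definition pres_relb (s t : term) : bool := `[< pres_rel s t >].
Lemma pres_relb_refl : reflexive pres_relb.
Proof. by move=> s; apply/asboolP/PresRefl. Qed.
Lemma pres_relb_sym : symmetric pres_relb.
Proof. by move=> s t; apply/asboolP/asboolP => /PresSym. Qed.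
Lemma pres_relb_trans : transitive pres_relb.
Proof.
move=> t s u /asboolP st /asboolP tu; apply/asboolP; exact: PresTrans st tu.
Qed.
Definition pres_equiv :=
  EquivRel pres_relb pres_relb_refl pres_relb_sym pres_relb_trans.

Definition pres_ring := {eq_quot pres_equiv}.
HB.instance Definition _ := Choice.on pres_ring.

Definition pres_pi (t : term) : pres_ring := \pi_({eq_quot pres_equiv}) t.

Lemma pres_piP s t : pres_pi s = pres_pi t <-> pres_rel s t.
Proof.
split=> [/eqmodP /asboolP //|st]; by apply/eqmodP/asboolP.
Qed.
Lemma pres_repr t : pres_rel (repr (pres_pi t)) t.
Proof. by apply/pres_piP; rewrite /pres_pi reprK. Qed.
Lemma pres_ind (Q : pres_ring -> Prop) :
  (forall t, Q (pres_pi t)) -> forall x, Q x.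
Proof. by move=> Qpi x; rewrite -[x]reprK; apply: Qpi. Qed.

Definition pres_add (x y : pres_ring) := pres_pi (AAdd (repr x) (repr y)).
Definition pres_mul (x y : pres_ring) := pres_pi (AMul (repr x) (repr y)).
Definition pres_opp (x : pres_ring) := pres_mul (pres_pi (AConst (-1))) x.

Lemma pres_addE s t : pres_add (pres_pi s) (pres_pi t) = pres_pi (AAdd s t).
Proof. by apply/pres_piP/PresAdd; apply: pres_repr. Qed.
Lemma pres_mulE s t : pres_mul (pres_pi s) (pres_pi t) = pres_pi (AMul s t).
Proof. by apply/pres_piP/PresMul; apply: pres_repr. Qed.

Lemma pres_addA : associative pres_add.
Proof.
elim/pres_ind=> s; elim/pres_ind=> t; elim/pres_ind=> u.
by rewrite !pres_addE; apply/pres_piP/PresAddA.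
Qed.
Lemma pres_addC : commutative pres_add.
Proof.
elim/pres_ind=> s; elim/pres_ind=> t.
by rewrite !pres_addE; apply/pres_piP/PresAddC.
Qed.
Lemma pres_add0 : left_id (pres_pi (AConst 0)) pres_add.
Proof. by elim/pres_ind=> s; rewrite pres_addE; apply/pres_piP/PresAdd0. Qed.
Lemma pres_mulA : associative pres_mul.
Proof.
elim/pres_ind=> s; elim/pres_ind=> t; elim/pres_ind=> u.
by rewrite !pres_mulE; apply/pres_piP/PresMulA.
Qed.
Lemma pres_mulC : commutative pres_mul.
Proof.
elim/pres_ind=> s; elim/pres_ind=> t.
by rewrite !pres_mulE; apply/pres_piP/PresMulC.
Qed.
Lemma pres_mul1 : left_id (pres_pi (AConst 1)) pres_mul.
Proof. by elim/pres_ind=> s; rewrite pres_mulE; apply/pres_piP/PresMul1. Qed.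
Lemma pres_mulDl : left_distributive pres_mul pres_add.
Proof.
elim/pres_ind=> s; elim/pres_ind=> t; elim/pres_ind=> u.
by rewrite !(pres_addE, pres_mulE); apply/pres_piP/PresMulDl.
Qed.
Lemma pres_constD r r' : pres_pi (AConst (r + r')) =
  pres_add (pres_pi (AConst r)) (pres_pi (AConst r')).
Proof. by rewrite pres_addE; apply/pres_piP/PresConstD. Qed.
Lemma pres_constM r r' : pres_pi (AConst (r * r')) =
  pres_mul (pres_pi (AConst r)) (pres_pi (AConst r')).
Proof. by rewrite pres_mulE; apply/pres_piP/PresConstM. Qed.

Lemma pres_addN : left_inverse (pres_pi (AConst 0)) pres_opp pres_add.
Proof.
elim/pres_ind=> s; rewrite /pres_opp pres_mulE pres_addE.
exact/pres_piP/PresAddN.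
Qed.

HB.instance Definition _ := GRing.isZmodule.Build pres_ring
  pres_addA pres_addC pres_add0 pres_addN.
HB.instance Definition _ := GRing.Zmodule_isComPzRing.Build pres_ring
  pres_mulA pres_mulC pres_mul1 pres_mulDl.

Definition pres_str : {rmorphism R -> pres_ring} :=
  @rmorphism_of R pres_ring (fun r => pres_pi (AConst r))
    pres_constD erefl pres_constM.

Definition pres_alg : calg R := CAlg pres_ring pres_str.

Definition pres_var (g : G) : pres_alg := pres_pi (AVar g).

Lemma alg_eval_var t : alg_eval pres_var t = pres_pi t.
Proof.
elim: t => //= [s -> t ->|s -> t ->]; first exact: pres_addE.
exact: pres_mulE.
Qed.

Lemma pres_var_rel s t : rel s t -> alg_eval pres_var s = alg_eval pres_var t.
Proof. by move=> st; rewrite !alg_eval_var; apply/pres_piP/PresRel. Qed.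

Lemma pres_hom_inj (A : calg R) (f f' : calg_hom pres_alg A) :
  (forall g, f (pres_var g) = f' (pres_var g)) -> f = f'.
Proof.
move=> ff'; apply: calg_hom_inj; elim/pres_ind=> t.
rewrite -alg_eval_var !alg_eval_map.
by congr alg_eval; apply: funext.
Qed.

Section PresHom.
Variables (A : calg R) (v : G -> A).
Hypothesis v_rel : forall s t, rel s t -> alg_eval v s = alg_eval v t.

Definition pres_hom_fun (x : pres_ring) : A := alg_eval v (repr x).

Lemma pres_hom_funE t : pres_hom_fun (pres_pi t) = alg_eval v t.
Proof. exact: pres_rel_eval v_rel _ _ (pres_repr t). Qed.

Lemma pres_hom_funD : {morph pres_hom_fun : x y / x + y}.
Proof.
elim/pres_ind=> s; elim/pres_ind=> t.
by rewrite [_ + _]pres_addE !pres_hom_funE.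
Qed.
Lemma pres_hom_funM : {morph pres_hom_fun : x y / x * y}.
Proof.
elim/pres_ind=> s; elim/pres_ind=> t.
by rewrite [_ * _]pres_mulE !pres_hom_funE.
Qed.
Lemma pres_hom_fun1 : pres_hom_fun 1 = 1.
Proof. by rewrite [LHS]pres_hom_funE /= rmorph1. Qed.

(** Together with [pres_hom_inj] this is the universal property: algebra morphisms out of [pres_alg]
    are the valuations of the generators that satisfy [rel]. *)
Definition pres_hom : calg_hom pres_alg A :=
  @CAlgHom R pres_alg A (rmorphism_of pres_hom_funD pres_hom_fun1 pres_hom_funM)
    (fun r => pres_hom_funE (AConst r)).

Lemma pres_homE g : pres_hom (pres_var g) = v g.
Proof. exact: pres_hom_funE. Qed.
End PresHom.

End PresentedAlgebra.

(** * Representable modules and the symmetric algebra *)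

Section Representable.
Variable R : comPzRingType.

(** Transport of structure: a natural bijection of sets with the points of [A] carries the module
    operations of [F] over to the functor of points. *)
Lemma representable_affine (F : rmodule R) (A : calg R)
    (f : forall B, F B -> calg_hom A B) (g : forall B, calg_hom A B -> F B) :
  (forall B C (h : calg_hom B C) x, f C (smap h x) = calg_comp h (f B x)) ->
  (forall B, cancel (f B) (g B)) -> (forall B, cancel (g B) (f B)) ->
  affine_mod F.
Proof.
move=> fn fK gK; exists A.
pose S := spec_fun A.
have gn B C (h : calg_hom B C) (x : S B) : g C (smap h x) = smap h (g B x).
  by rewrite -[RHS]fK fn gK.
unshelve eexists (@ModuleOn R S (fun B => f B rzero) (fun B x => f B (ropp (g B
  x)))
  (fun B x y => f B (radd (g B x) (g B y))) (fun B a x => f B (rscale a (g B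
    x)))
  _ _ _ _ _ _ _ _ _ _).
- by move=> B x y z; rewrite !fK raddA.
- by move=> B x y; rewrite raddC.
- by move=> B x; rewrite fK radd0 gK.
- by move=> B x; rewrite fK raddN.
- by move=> B a b x /=; rewrite fK rscaleA.
- by move=> B x /=; rewrite rscale1 gK.
- by move=> B a x y /=; rewrite !fK rscaleDr.
- by move=> B a b x /=; rewrite !fK rscaleDl.
- by move=> B C h x y /=; rewrite !gn -rmapD [RHS]fn.
- by move=> B C h a x /=; rewrite !gn -rmapZ [RHS]fn.
set G := RModule _ _.
have @u : rmor F G.
  refine (@RMor R F G f fn _ _).
  - by move=> B x y; rewrite /G /radd /= !fK.
  - by move=> B a x; rewrite /G /rscale /= !fK.
exists u; apply: bij_riso => B; first exact: can_inj (fK B).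
by move=> y; exists (g B y); apply: gK.
Qed.

Lemma riso_affine (F G : rmodule R) :
  risomorphic F G -> affine_mod G -> affine_mod F.
Proof. by move=> FG [A [s Gs]]; exists A, s; apply: riso_trans FG Gs. Qed.

Section DualAffine.
Variable W : lmodType R.

(** These relations present the symmetric algebra of [W]. *)
Inductive sym_rel : alg_term R W -> alg_term R W -> Prop :=
| SymAdd w w' : sym_rel (AVar (w + w')) (AAdd (AVar w) (AVar w'))
| SymScale r w : sym_rel (AVar (r *: w)) (AMul (AConst r) (AVar w)).

Lemma sym_rel_dev (B : calg R) (x : dual_qcoh W B) s t :
  sym_rel s t -> alg_eval (dev x) s = alg_eval (dev x) t.
Proof. by case=> [w w'|r w] /=; rewrite ?dev_addr ?dev_scaler. Qed.

Lemma sym_var_linear (B : calg R) (h : calg_hom (pres_alg sym_rel) B) :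
  linear (fun w => h (pres_var sym_rel w) : calg_lmod B).
Proof.
move=> r w w'; rewrite calg_lmodZ -(calg_homE h) -rmorphM -rmorphD.
congr (h _); rewrite [LHS](pres_var_rel (SymAdd _ _)) /=; congr (_ + _).
exact: (pres_var_rel (SymScale _ _)).
Qed.

(** Algebra morphisms $\mathrm{Sym}(W)\to B$ are the $R$-linear maps $W\to B$, which are the points
    of $W^*(B)$. *)
Lemma dual_qcoh_affine : affine_mod (dual_qcoh W).
Proof.
apply: (@representable_affine (dual_qcoh W) (pres_alg sym_rel)
  (fun B x => pres_hom (@sym_rel_dev B x))
  (fun B h => dmk (linear_of (sym_var_linear h)))).
- move=> B C h x; apply: pres_hom_inj => w.
  rewrite pres_homE dev_map -[in LHS](pres_homE (@sym_rel_dev B x) w).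
  by rewrite /=.
- move=> B x; apply: (@dev_inj R W B) => w; rewrite dev_dmk.
  exact: (pres_homE (@sym_rel_dev B x) w).
- by move=> B h; apply: pres_hom_inj => w; rewrite pres_homE dev_dmk.
Qed.

Lemma dual_qcoh_reflexive_affine F :
  risomorphic F (dual_qcoh W) -> reflexive_affine_mod F.
Proof.
move=> FW; split; last exact: riso_affine FW dual_qcoh_affine.
exact: riso_reflexive FW (@dual_qcoh_reflexive _ _).
Qed.
End DualAffine.
End Representable.

(** * Flat Mittag-Leffler modules *)

Lemma map_eq_cat (T T' : Type) (f : T -> T') s t t' :
  map f s = t ++ t' ->
  exists u u', [/\ s = u ++ u', map f u = t & map f u' = t'].
Proof.
move=> fs; exists (take (size t) s), (drop (size t) s).
by rewrite cat_take_drop map_take map_drop fs take_size_cat ?drop_size_cat.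
Qed.

Lemma tensor_rel_mapl (R : comPzRingType) (M M' : lmodType R) (A : calg R)
    (g : {linear M -> M'}) (s t : seq (M * A)) :
  tensor_rel s t ->
  tensor_rel [seq (g p.1, p.2) | p <- s] [seq (g p.1, p.2) | p <- t].
Proof.
elim=> {s t} /=.
- by move=> s; apply: TensorRefl.
- by move=> s t _; apply: TensorSym.
- by move=> s t u _ + _; apply: TensorTrans.
- by move=> s s' t t' _ + _; rewrite !map_cat; apply: TensorCat.
- by move=> s t; rewrite !map_cat; apply: TensorCatC.
- by move=> *; rewrite linearD; apply: TensorDl.
- by move=> *; apply: TensorDr.
- by move=> *; rewrite linearZ; apply: TensorZ.
- by move=> *; rewrite linear0; apply: Tensor0.
Qed.

(** Since $x=Py$, every solution of $aP=0$ satisfies $\sum_k x_k\otimes a_k=0$; the second clause is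
    the converse, so that [x] and [P] have the same kernel over every algebra. *)
Definition factors_stably (R : comPzRingType) (M : lmodType R) n
    (x : 'I_n -> M) : Prop :=
  exists m (y : 'I_m -> M) (P : 'I_n -> 'I_m -> R),
    (forall k, x k = \sum_j P k j *: y j) /\
    forall (A : calg R) (a : 'I_n -> A), \sum_k tmul (x k) (a k) = 0 ->
      forall j, \sum_k a k * calg_str A (P k j) = 0.

Definition stable_factorization (R : comPzRingType) (M : lmodType R) : Prop :=
  forall n (x : 'I_n -> M), factors_stably x.

(** * Tensor products commute with direct limits *)

Section TensorLimit.
Variables (R : comPzRingType) (I : Type) (le : I -> I -> Prop).
Variables (L : I -> lmodType R) (tr : forall i j,
  le i j -> {linear L i -> L j}).
Variables (M : lmodType R) (phi : forall i, {linear L i -> M}).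
Hypothesis lim : lmod_dirlim tr phi.

Let dirle := ls_dir (proj1 lim).
Let trans := dir_trans dirle.
Let ub := dir_ub dirle.
Let tr_comp := ls_comp (proj1 lim).
Let phi_tr i j (ij : le i j) x : phi j (tr ij x) = phi i x :=
  lc_compat (proj2 lim) ij x.
Let phi_surj := lc_surj (proj2 lim).

Lemma limit_eq i (x y : L i) : phi i x = phi i y ->
  exists k (ik : le i k), tr ik x = tr ik y.
Proof.
move=> /(lc_inj (proj2 lim)) [k [ik [ik' xy]]]; exists k, ik.
by rewrite xy (Prop_irrelevance ik ik').
Qed.

Lemma limit_lift_family n (x : 'I_n -> M) :
  exists i (x' : 'I_n -> L i), forall k, phi i (x' k) = x k.
Proof.
elim: n x => [|n IHn] x.
  have [i] := dir_inhabited dirle.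
  by exists i, (fun=> 0) => -[].
have [i [x' x'E]] := IHn (fun k => x (lift ord0 k)).
have [j [z zE]] := phi_surj (x ord0).
have [l [il jl]] := ub i j.
exists l, (fun k => if unlift ord0 k is Some k' then tr il (x' k') else tr jl
  z).
by move=> k; case: unliftP => [k' ->|->]; rewrite phi_tr.
Qed.

Variable A : calg R.
Let up i j (ij : le i j) (s : seq (L i * A)) := [seq (tr ij p.1, p.2) | p <- s].
Let fin i (s : seq (L i * A)) := [seq (phi i p.1, p.2) | p <- s].

Let up_comp i j k (ij : le i j) (jk : le j k) (ik : le i k) s :
  up jk (up ij s) = up ik s.
Proof. by rewrite /up -map_comp; apply: eq_map => p /=; rewrite tr_comp. Qed.

Let fin_up i j (ij : le i j) s : fin (up ij s) = fin s.
Proof. by rewrite /fin -map_comp; apply: eq_map => p /=; rewrite phi_tr. Qed.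

Let up_cat i j (ij : le i j) s t : up ij (s ++ t) = up ij s ++ up ij t.
Proof. exact: map_cat. Qed.

Let fin_lift i (s : seq (M * A)) : exists j (ij : le i j) s',
  fin (i := j) s' = s.
Proof.
elim: s => [|[m a] s [j [ij [s' s'E]]]].
  by exists i, (dir_refl dirle i), [::].
have [k [z zE]] := phi_surj m.
have [l [jl kl]] := ub j k.
exists l, (trans ij jl), ((tr kl z, a) :: up jl s').
by rewrite -[s]s'E -(fin_up jl) /= phi_tr zE.
Qed.

Let eventually i (s t : seq (L i * A)) :=
  exists j (ij : le i j), tensor_rel (up ij s) (up ij t).

Let eventually_ge i (s t : seq (L i * A)) j (ij : le i j) :
  eventually s t -> exists k (jk : le j k), forall ik : le i k,
    tensor_rel (up ik s) (up ik t).
Proof.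
move=> [l [il st]]; have [k [jk lk]] := ub j l.
exists k, jk => ik; rewrite -!(up_comp il lk ik).
exact: (tensor_rel_mapl (tr lk)).
Qed.

Let eventually_up i (s t : seq (L i * A)) j (ij : le i j) :
  eventually (up ij s) (up ij t) -> eventually s t.
Proof.
move=> [k [jk]]; rewrite !(up_comp ij jk (trans ij jk)).
by exists k, (trans ij jk).
Qed.

Let eventually_fin i (s t : seq (L i * A)) : fin s = fin t -> eventually s t.
Proof.
elim: s t => [|[x a] s IHs] [|[y b] t] //= => [_|].
  by exists i, (dir_refl dirle i); apply: TensorRefl.
move=> [/limit_eq [k [ik xy]] <- /IHs st].
have [l [kl stl]] := eventually_ge ik st.
exists l, (trans ik kl) => /=.
rewrite -!(tr_comp ik kl (trans ik kl)) xy.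
exact: (TensorCat (TensorRefl [:: (tr kl (tr ik y), a)]) (stl (trans ik kl))).
Qed.

(** Induction on the derivation: each elementary relation between images in [M] uses finitely many
    equalities in [M], and these hold at some later index. *)
Lemma tensor_rel_limit s t : tensor_rel s t ->
  forall i (s' t' : seq (L i * A)),
    fin s' = s -> fin t' = t -> eventually s' t'.
Proof.
elim=> {s t}.
- by move=> s i s' t' s'E t'E; apply: eventually_fin; rewrite s'E t'E.
- move=> s t _ IH i s' t' s'E t'E.
  by have [k [ik /TensorSym]] := IH i t' s' t'E s'E; exists k, ik.
- move=> s t u _ IHst _ IHtu i s' u' s'E u'E.
  (* The intermediate list need not come from [i]; it is lifted to some later [j], where both halves
     are compared. *)
  have [j [ij [t' t'E]]] := fin_lift i t.
  apply: (eventually_up (ij := ij)).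
  have [k [jk st]] := IHst j (up ij s') t' (etrans (fin_up _ _) s'E) t'E.
  have tu := IHtu j t' (up ij u') t'E (etrans (fin_up _ _) u'E).
  have [l [kl tul]] := eventually_ge jk tu.
  exists l, (trans jk kl); apply: TensorTrans (tul _).
  by rewrite -!(up_comp jk kl (trans jk kl)); apply: (tensor_rel_mapl (tr kl)).
- move=> s1 s1' s2 s2' _ IH1 _ IH2 i s' t' /map_eq_cat [u1 [u2 [-> u1E u2E]]].
  move=> /map_eq_cat [v1 [v2 [-> v1E v2E]]].
  have [k [ik uv1]] := IH1 i _ _ u1E v1E.
  have [l [kl uv2]] := eventually_ge ik (IH2 i _ _ u2E v2E).
  exists l, (trans ik kl); rewrite !up_cat; apply: TensorCat (uv2 _).
  by rewrite -!(up_comp ik kl (trans ik kl)); apply: (tensor_rel_mapl (tr kl)).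
- move=> s1 s2 i s' t' s'E; move: (s'E) => /map_eq_cat [u1 [u2 [-> u1E u2E]]].
  move=> t'E; have : fin t' = fin (u2 ++ u1) by rewrite /fin map_cat u1E u2E.
  move=> /eventually_fin [k [ik uv]]; exists k, ik.
  rewrite up_cat; apply: TensorTrans (TensorSym uv); rewrite up_cat.
  exact: TensorCatC.
- move=> m m' a i [|[x b] []] // [|[y c] [|[z d] []]] // [xE ->] [yE -> zE ->].
  have [|k [ik e]] := @limit_eq i x (y + z); first by rewrite linearD xE yE zE.
  by exists k, ik; rewrite /= e linearD; apply: TensorDl.
- move=> m a a' i [|[x b] []] // [|[y c] [|[z d] []]] // [xE ->] [yE -> zE ->].
  have [|k [ik e]] := eventually_fin (s := [:: (x, a); (x, a')]) (t := [:: (y,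
    a); (z, a')]).
    by rewrite /= xE yE zE.
  exists k, ik; apply: TensorTrans e; exact: TensorDr.
- move=> r m a i [|[x b] []] // [|[y c] []] // [xE ->] [yE ->].
  have [|k [ik e]] := @limit_eq i x (r *: y); first by rewrite linearZ yE xE.
  by exists k, ik; rewrite /= e linearZ; apply: TensorZ.
- move=> a i [|[x b] []] // [|//] [xE ->] _.
  have [|k [ik e]] := @limit_eq i x 0; first by rewrite linear0 xE.
  by exists k, ik; rewrite /= e linear0; apply: Tensor0.
Qed.

Lemma tensor_limit0 i n (x : 'I_n -> L i) (a : 'I_n -> A) :
  \sum_k tmul (phi i (x k)) (a k) = 0 ->
  exists j (ij : le i j), \sum_k tmul (tr ij (x k)) (a k) = 0.
Proof.
pose s := [seq (x k, a k) | k <- index_enum 'I_n].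
have sE (V : lmodType R) (g : L i -> V) :
    \sum_k tmul (g (x k)) (a k) = tensor_pi [seq (g p.1, p.2) | p <- s].
  by rewrite tensor_pi_sum !big_map.
rewrite sE => /tensor_piP /tensor_rel_limit - /(_ i s [::] erefl erefl).
by move=> [j [ij /tensor_piP st]]; exists j, ij; rewrite sE.
Qed.
End TensorLimit.

(** * From the Mittag-Leffler condition to stable factorizations; relations as spans *)

Section FlatMittagLeffler.
Variables (R : comPzRingType) (M : lmodType R).

Lemma row_scalar_sum m (w : {scalar 'rV[R]_m}) (u : 'rV[R]_m) :
  w u = \sum_j u 0 j * w (delta_mx 0 j).
Proof.
rewrite {1}[u]row_sum_delta linear_sum.
by apply: eq_bigr => j _; rewrite linearZ.
Qed.

Lemma row_linear_sum m (V : lmodType R) (g : {linear 'rV[R]_m -> V}) (u :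
  'rV[R]_m) :
  g u = \sum_j u 0 j *: g (delta_mx 0 j).
Proof.
rewrite {1}[u]row_sum_delta linear_sum.
by apply: eq_bigr => j _; rewrite linearZ.
Qed.

(** A relation of [x] over $A$ already holds in $L_k\otimes A$ for some $k\ge j$. Each coordinate
    form of $L_j$, pulled back to $L_i$, comes from a form [u] on $L_k$ by the Mittag-Leffler
    condition, and contracting the relation with [u] gives one equation of $aP=0$. *)
Lemma flat_ml_stable : flat_mittag_leffler M -> stable_factorization M.
Proof.
move=> [I [le [L [tr [phi [lim free ml]]]]]] n x.
have [i [x' x'E]] := limit_lift_family lim x.
have [j [ij mlij]] := ml i.
have [m [f [g fK gK]]] := free j.
have g_lin : linear g := can2_linear fK gK.
pose G : {linear 'rV[R]_m -> L j} := linear_of g_lin.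
exists m, (fun l => phi j (G (delta_mx 0 l))),
  (fun k l => f (tr i j ij (x' k)) 0 l).
split=> [k|A a].
  transitivity (phi j (G (f (tr i j ij (x' k))))).
    by rewrite /= fK (lc_compat (proj2 lim)) x'E.
  rewrite (row_linear_sum G) linear_sum; apply: eq_bigr => l _.
  by rewrite [LHS]linearZ.
under eq_bigr do rewrite -x'E.
move=> /(tensor_limit0 lim) [k0 [ik0 k0E]] l.
have [k [jk k0k]] := dir_ub (ls_dir (proj1 lim)) j k0.
have ik := dir_trans (ls_dir (proj1 lim)) ij jk.
have wP : scalar (fun z : L i => f (tr i j ij z) 0 l).
  by move=> r z z'; rewrite !linearP !mxE.
have uP : scalar (fun z : L j => f z 0 l).
  by move=> r z z'; rewrite !linearP !mxE.
have [_ w_im] := mlij k jk ik (scalar_of wP).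
have [|u uE] := w_im; first by exists (scalar_of uP).
have kE : \sum_k1 tmul (tr i k ik (x' k1)) (a k1) = 0 :> tensor (L k) A.
  have /(congr1 (tensor_mapl A (tr k0 k k0k))) := k0E.
  rewrite raddf0 raddf_sum; apply: etrans; apply: eq_bigr => k1 _.
  by rewrite tensor_mapl_tmul (ls_comp (proj1 lim)).
have /(congr1 (tensor_contract A u)) := kE.
rewrite raddf0 raddf_sum; apply: etrans; apply: eq_bigr => k1 _.
by rewrite tensor_contract_tmul uE.
Qed.

(* Specialize to the square-zero algebra R (+) R^n / C, with C the span of
   the c_j, at the classes of the unit vectors. *)
Lemma relations_span n m (c : 'I_m -> 'rV[R]_n) (d : 'rV[R]_n) :
  (forall (A : calg R) (a : 'I_n -> A),
     (forall j, \sum_k a k * calg_str A (c j 0 k) = 0) ->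
     \sum_k a k * calg_str A (d 0 k) = 0) ->
  exists t : 'I_m -> R, d = \sum_j t j *: c j.
Proof.
move=> cd; pose C (e : 'rV[R]_n) := exists t : 'I_m -> R, e = \sum_j t j *: c j.
have subC : submod_prop C.
  split.
  - by exists (fun=> 0); rewrite big1 // => j _; rewrite scale0r.
  - move=> e e' [t ->] [t' ->]; exists (fun j => t j + t' j).
    by rewrite -big_split; apply: eq_bigr => j _; rewrite scalerDl.
  - move=> r e [t ->]; exists (fun j => r * t j).
    by rewrite scaler_sumr; apply: eq_bigr => j _; rewrite scalerA.
pose A := sqz (A := calg_base R) (quot_mod subC : lmodType R).
pose a k : A := (0, quot_pi subC (delta_mx 0 k)).
have aE (e : 'rV[R]_n) :
    \sum_k a k * calg_str A (e 0 k) = (0, quot_pi subC e) :> A.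
  have aeE k : a k * calg_str A (e 0 k) =
      (0, quot_pi subC (e 0 k *: delta_mx 0 k)) :> A.
    by congr pair; rewrite /= ?mul0r // scale0r add0r linearZ.
  under eq_bigr do rewrite aeE.
  rewrite {2}[e]row_sum_delta linear_sum.
  symmetry; apply: (big_morph (fun u => (0, u) : A)) => //; exact: sqz_inrD.
have ca j : \sum_k a k * calg_str A (c j 0 k) = 0 :> A.
  rewrite aE; congr pair; apply/quot_pi0P; exists (fun i => (i == j)%:R).
  rewrite (bigD1 j) //= eqxx scale1r big1 ?addr0 // => i /negPf ->.
  by rewrite scale0r.
by have := cd A a ca; rewrite aE => /(congr1 snd) /quot_pi0P.
Qed.
End FlatMittagLeffler.

Lemma tmul_subst (R : comPzRingType) (M : lmodType R) n m (x : 'I_n -> M)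
    (y : 'I_m -> M) (P : 'I_n -> 'I_m -> R) (A : calg R) (a : 'I_n -> A) :
  (forall k, x k = \sum_j P k j *: y j) ->
  \sum_k tmul (x k) (a k) =
  \sum_j tmul (y j) (\sum_k a k * calg_str A (P k j)).
Proof.
move=> xP; under eq_bigr do rewrite xP tmul_suml.
rewrite exchange_big; apply: eq_bigr => j _; rewrite tmul_sumr.
by apply: eq_bigr => k _; rewrite tmulZ mulrC.
Qed.

Lemma tmul_base_sum (R : comPzRingType) (M : lmodType R) n (x : 'I_n -> M)
    (b : 'I_n -> R) :
  \sum_k tmul (x k) (b k : calg_base R) =
  tmul (\sum_k b k *: x k) (1 : calg_base R).
Proof.
by rewrite tmul_suml; apply: eq_bigr => k _; rewrite tmulZ mulr1.
Qed.

(** * The direct system indexed by stable factorizations *)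

Section StableFlatML.
Variables (R : comPzRingType) (M : lmodType R).

Record stable_fact := StableFact {
  sf_n : nat;
  sf_m : nat;
  sf_x : 'I_sf_n -> M;
  sf_y : 'I_sf_m -> M;
  sf_P : 'I_sf_n -> 'I_sf_m -> R;
  sf_xE : forall k, sf_x k = \sum_j sf_P k j *: sf_y j;
  sf_ker : forall (A : calg R) (a : 'I_sf_n -> A),
    \sum_k tmul (sf_x k) (a k) = 0 ->
    forall j, \sum_k a k * calg_str A (sf_P k j) = 0 }.

Arguments sf_x : clear implicits.
Arguments sf_y : clear implicits.
Arguments sf_P : clear implicits.
Arguments sf_xE : clear implicits.
Arguments sf_ker : clear implicits.

(* The rank component makes the strict order irreflexive, so that the
   transition maps, which are not identities when source and target share the
   same factorization, are well defined. *)
Definition sf_idx := (nat * stable_fact)%type.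
Implicit Types i j : sf_idx.

Definition sf_spans i j := exists Q : 'I_(sf_m i.2) -> 'I_(sf_n j.2) -> R,
  forall k, sf_y i.2 k = \sum_l Q k l *: sf_x j.2 l.

Definition sf_lt i j := (i.1 < j.1)%N /\ sf_spans i j.
Definition sf_le i j := i = j \/ sf_lt i j.

Definition sf_phi i (u : 'rV[R]_(sf_m i.2)) : M := \sum_k u 0 k *: sf_y i.2 k.

Lemma sf_phi_linear i : linear (@sf_phi i).
Proof.
move=> r u v; rewrite /sf_phi scaler_sumr -big_split; apply: eq_bigr => k _ /=.
by rewrite !mxE scalerDl scalerA.
Qed.
Definition sf_cocone i := linear_of (@sf_phi_linear i).

Definition sf_mx j : 'M[R]_(sf_n j.2, sf_m j.2) := \matrix_(k, l) sf_P j.2 k l.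

(** Two coefficient vectors of the same element of $M$ differ by a relation of [sf_x] over [R],
    which [sf_ker] places in the kernel of [sf_P]. *)
Lemma sf_mx_inj j (b b' : 'rV[R]_(sf_n j.2)) :
  \sum_k b 0 k *: sf_x j.2 k = \sum_k b' 0 k *: sf_x j.2 k ->
  b *m sf_mx j = b' *m sf_mx j.
Proof.
move=> bb'; apply/eqP; rewrite -subr_eq0 -mulmxBl; apply/eqP/rowP => l.
have := sf_ker j.2 (calg_base R) (fun k => (b - b') 0 k).
rewrite tmul_base_sum; set z := \sum_k _; have -> : z = 0.
  rewrite /z; under eq_bigr do rewrite !mxE scalerBl.
  by rewrite sumrB bb' subrr.
have -> : tmul 0 1 = 0 :> tensor M (calg_base R).
  exact: (raddf0 (additive_of (tmul_addl _))).
move=> /(_ erefl l) bPl; rewrite mxE [RHS]mxE; apply: etrans bPl.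
by apply: eq_bigr => k _; rewrite [sf_mx _ _ _]mxE.
Qed.

Lemma sf_phi_mx j (b : 'rV[R]_(sf_n j.2)) :
  sf_phi (b *m sf_mx j) = \sum_k b 0 k *: sf_x j.2 k.
Proof.
rewrite /sf_phi.
under eq_bigr do rewrite mxE scaler_suml.
rewrite exchange_big; apply: eq_bigr => k _.
rewrite sf_xE scaler_sumr; apply: eq_bigr => l _.
by rewrite mxE scalerA.
Qed.

(** For distinct indices: express [sf_y] of [i] through [sf_x] of [j] by a chosen [Q], then apply
    the matrix of [j]. By [sf_mx_inj] the result does not depend on [Q], as [sf_trE] records. *)
Definition sf_tr i j (ij : sf_le i j) : {linear 'rV[R]_(sf_m i.2) ->
  'rV[R]_(sf_m j.2)} :=
  match pselect (i = j) with
  | left e => eq_rect i (fun j => {linear 'rV[R]_(sf_m i.2) -> 'rV[R]_(sf_m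
    j.2)}) idfun j e
  | right ne =>
      let Q := sval (cid (proj2 (or_ind (fun e => False_ind _ (ne e)) id ij)))
        in
      mulmxr ((\matrix_(k, l) Q k l) *m sf_mx j)
  end.

Lemma sf_tr_id i (ii : sf_le i i) u : sf_tr ii u = u.
Proof.
rewrite /sf_tr; case: pselect => // e.
by rewrite (Prop_irrelevance e erefl).
Qed.

Lemma sf_trE i j (ij : sf_le i j) u (b : 'rV[R]_(sf_n j.2)) : i <> j ->
  sf_phi u = \sum_k b 0 k *: sf_x j.2 k -> sf_tr ij u = b *m sf_mx j.
Proof.
move=> ne ub; rewrite /sf_tr; case: pselect => // ne'.
case: (cid _) => Q QE.
rewrite /= mulmxA; apply: sf_mx_inj; rewrite -ub /sf_phi.
under eq_bigr do rewrite mxE scaler_suml.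
rewrite exchange_big; apply: eq_bigr => k _.
rewrite QE scaler_sumr; apply: eq_bigr => l _.
by rewrite mxE scalerA.
Qed.

Lemma sf_span i j (ij : sf_lt i j) (u : 'rV[R]_(sf_m i.2)) :
  exists b : 'rV[R]_(sf_n j.2), sf_phi u = \sum_k b 0 k *: sf_x j.2 k.
Proof.
have [_ [Q QE]] := ij; exists (\row_l \sum_k u 0 k * Q k l).
under [RHS]eq_bigr do rewrite mxE scaler_suml.
rewrite exchange_big; apply: eq_bigr => k _.
rewrite QE scaler_sumr; apply: eq_bigr => l _.
by rewrite scalerA.
Qed.

Lemma sf_lt_neq i j : sf_lt i j -> i <> j.
Proof. by move=> [ij _] e; move: ij; rewrite e ltnn. Qed.

Lemma sf_le_lt i j : sf_le i j -> i <> j -> sf_lt i j.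
Proof. by case. Qed.

Lemma sf_phi_tr i j (ij : sf_le i j) u : sf_phi (sf_tr ij u) = sf_phi u.
Proof.
have [e|ne] := pselect (i = j).
  by case: _ / e in ij *; rewrite sf_tr_id.
have [b ub] := sf_span (sf_le_lt ij ne) u.
by rewrite (sf_trE ij ne ub) sf_phi_mx.
Qed.

Lemma sf_lt_trans i j k : sf_lt i j -> sf_lt j k -> sf_lt i k.
Proof.
move=> [ij [Q QE]] jk; split; first exact: ltn_trans ij jk.1.
(* The rows of $QP$, with $P$ the matrix of [j], represent [sf_y] of [i] in the free module of [j];
   [sf_span] expresses their images in $M$ through [sf_x] of [k]. *)
pose b l := sval (cid (sf_span jk (\row_p \sum_q Q l q * sf_P j.2 q p))).
have bE l := svalP (cid (sf_span jk (\row_p \sum_q Q l q * sf_P j.2 q p))).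
exists (fun l => b l 0) => l; rewrite -bE QE.
transitivity (sf_phi ((\row_q Q l q) *m sf_mx j)).
  by rewrite sf_phi_mx; apply: eq_bigr => q _; rewrite mxE.
congr sf_phi; apply/rowP => p; rewrite !mxE; apply: eq_bigr => q _.
by rewrite !mxE.
Qed.

Lemma sf_le_trans i j k : sf_le i j -> sf_le j k -> sf_le i k.
Proof.
move=> [->//|ij] [<-|jk]; right => //; exact: sf_lt_trans ij jk.
Qed.

Lemma sf_tr_comp i j k (ij : sf_le i j) (jk : sf_le j k) (ik : sf_le i k) u :
  sf_tr jk (sf_tr ij u) = sf_tr ik u.
Proof.
have [e|ne] := pselect (i = j).
  case: _ / e in ij jk *; rewrite sf_tr_id.
  by rewrite (Prop_irrelevance jk ik).
have [e|ne'] := pselect (j = k).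
  by case: _ / e in jk ik *; rewrite sf_tr_id (Prop_irrelevance ij ik).
have lij := sf_le_lt ij ne; have ljk := sf_le_lt jk ne'.
have [b ub] := sf_span ljk (sf_tr ij u).
rewrite (sf_trE jk ne' ub) (sf_trE ik (sf_lt_neq (sf_lt_trans lij ljk)) (b :=
  b)) //.
by rewrite -ub sf_phi_tr.
Qed.

Hypothesis stable : stable_factorization M.

Lemma stable_factE n (x : 'I_n -> M) :
  exists f : stable_fact, exists e : sf_n f = n, forall k,
    sf_x f k = x (cast_ord e k).
Proof.
have [m [y [P [xP Pker]]]] := stable x.
by exists (StableFact xP Pker), erefl => k; rewrite cast_ord_id.
Qed.

(** Factor the concatenation of the two families [sf_y], at a rank larger than both. *)
Lemma sf_ub i j : exists k, sf_lt i k /\ sf_lt j k.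
Proof.
pose x (l : 'I_(sf_m i.2 + sf_m j.2)) :=
  match split l with inl p => sf_y i.2 p | inr p => sf_y j.2 p end.
have [f [e fx]] := stable_factE x.
exists ((maxn i.1 j.1).+1, f); split; split;
  rewrite /= ?ltnS ?leq_maxl ?leq_maxr //.
- exists (fun p l => (l == cast_ord (esym e) (lshift _ p))%:R) => p.
  rewrite (bigD1 (cast_ord (esym e) (lshift _ p))) //= eqxx scale1r fx
    cast_ordKV.
  rewrite big1 ?addr0 => [|l /negPf ->]; last by rewrite scale0r.
  rewrite /x; case: splitP => [q pq|q /= e'].
    by rewrite (_ : p = q) //; apply: val_inj.
  by have := ltn_ord p; rewrite e' ltnNge leq_addr.
- exists (fun p l => (l == cast_ord (esym e) (rshift _ p))%:R) => p.
  rewrite (bigD1 (cast_ord (esym e) (rshift _ p))) //= eqxx scale1r fx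
    cast_ordKV.
  rewrite big1 ?addr0 => [|l /negPf ->]; last by rewrite scale0r.
  rewrite /x; case: splitP => [q /= e'|q /= /addnI pq].
    by have := ltn_ord q; rewrite -e' ltnNge leq_addr.
  by rewrite (_ : p = q) //; apply: val_inj.
Qed.

(** An element of $M$ is reached by factoring it as a family of length one. For injectivity any
    strict upper bound works: by [sf_trE], a strict transition map sends a vector to a value that
    depends only on its image in $M$. *)
Lemma sf_dirlim : lmod_dirlim sf_tr sf_cocone.
Proof.
split.
  split=> [|i ii x|i j k ij jk ik x]; [|exact: sf_tr_id|exact: sf_tr_comp].
  split.
  - have [f _] := stable_factE (fun k : 'I_0 => 0 : M).
    exact: (inhabits (0%N, f)).
  - by move=> i; left.
  - by move=> i j k; apply: sf_le_trans.
  - by move=> i j; have [k [ik jk]] := sf_ub i j; exists k; split; right.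
split.
- by move=> i j ij u; apply: sf_phi_tr.
- move=> x; have [f [e fx]] := stable_factE (fun k : 'I_1 => x).
  pose i : sf_idx := (0%N, f).
  pose b : 'rV[R]_(sf_n i.2) := \row_k (k == cast_ord (esym e) ord0)%:R.
  exists i, (b *m sf_mx i); rewrite [LHS]sf_phi_mx.
  rewrite (bigD1 (cast_ord (esym e) ord0)) //= fx mxE eqxx scale1r.
  by rewrite big1 ?addr0 // => k /negPf ke; rewrite mxE ke scale0r.
move=> i j u v uv; have [k [ik jk]] := sf_ub i j.
exists k, (or_intror ik), (or_intror jk).
have [b ub] := sf_span ik u.
rewrite (sf_trE _ (sf_lt_neq ik) ub).
by rewrite (sf_trE _ (sf_lt_neq jk) (b := b)) // -ub; symmetry.
Qed.

Lemma sf_phi_delta i p : sf_phi (delta_mx 0 p : 'rV[R]_(sf_m i.2)) = sf_y i.2 p.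
Proof.
rewrite /sf_phi (bigD1 p) //= mxE !eqxx scale1r big1 ?addr0 // => k /negPf kp.
by rewrite mxE kp scale0r.
Qed.

Lemma sf_y_tr i j (ij : sf_le i j) p :
  sf_y i.2 p = \sum_l sf_tr ij (delta_mx 0 p) 0 l *: sf_y j.2 l.
Proof. by rewrite -(sf_phi_delta p) -(sf_phi_tr ij). Qed.

(* The left-hand side does not involve j: this gives the Mittag-Leffler
   condition. *)
Lemma sf_tr_ker i j (ij : sf_lt i j) (A : calg R) (a : 'I_(sf_m i.2) -> A) :
  \sum_p tmul (sf_y i.2 p) (a p) = 0 <-> forall l,
    \sum_p a p * calg_str A (sf_tr (or_intror ij) (delta_mx 0 p) 0 l) = 0.
Proof.
split=> [|a0]; last first.
  rewrite (tmul_subst a (sf_y_tr (or_intror ij))) big1 // => l _.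
  by rewrite a0 tmul0r.
have [_ [Q QE]] := ij; rewrite (tmul_subst a QE) => /sf_ker a0 l.
apply: (etrans _ (a0 l)); under [RHS]eq_bigr do rewrite mulr_suml.
rewrite exchange_big; apply: eq_bigr => p _.
have -> : sf_tr (or_intror ij) (delta_mx 0 p) = (\row_q Q p q) *m sf_mx j.
  apply: (sf_trE _ (sf_lt_neq ij)); rewrite sf_phi_delta QE.
  by apply: eq_bigr => q _; rewrite mxE.
rewrite mxE rmorph_sum mulr_sumr; apply: eq_bigr => q _.
by rewrite !mxE rmorphM mulrA.
Qed.

(** By [sf_tr_ker], all strict transition maps out of [i] have the same kernel over every algebra. A
    form on the module of [i] that factors through [j] thus vanishes on the kernel for [k], and
    [relations_span] makes it a combination of the columns of the transition matrix to [k]. *)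
Lemma sf_dual_ml : dual_mittag_leffler sf_tr.
Proof.
move=> i; have [j [ij _]] := sf_ub i i.
exists j, (or_intror ij) => k jk ik w; split=> [[u uw]|[u uw]].
  exists (scalar_of (linearP (u \o sf_tr jk))) => x.
  by rewrite /= (sf_tr_comp (or_intror ij) jk ik) uw.
have [e|ne] := pselect (j = k).
  case: _ / e in jk ik *; rewrite (Prop_irrelevance ik (or_intror ij)).
  by exists u.
have lik := sf_lt_trans ij (sf_le_lt jk ne).
rewrite (Prop_irrelevance ik (or_intror lik)).
pose c l : 'rV[R]_(sf_m i.2) := \row_p sf_tr (or_intror lik) (delta_mx 0 p) 0 l.
have [|t tE] := @relations_span R _ _ c (\row_p w (delta_mx 0 p)).
  move=> A a ac.
  have /(sf_tr_ker ij) a0 : \sum_p tmul (sf_y i.2 p) (a p) = 0.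
    apply/(sf_tr_ker lik) => l; rewrite -[RHS](ac l).
    by apply: eq_bigr => p _; rewrite mxE.
  under eq_bigr do rewrite mxE -uw (row_scalar_sum u) rmorph_sum mulr_sumr.
  rewrite exchange_big big1 // => l _.
  apply: (etrans _ (mul0r (calg_str A (u (delta_mx 0 l))))).
  apply: (etrans _ (congr1 ( *%R^~ _) (a0 l))); rewrite mulr_suml.
  by apply: eq_bigr => p _; rewrite rmorphM mulrA.
have vP : scalar (fun v : 'rV[R]_(sf_m k.2) => \sum_l v 0 l * t l).
  move=> r v v'; rewrite mulr_sumr -big_split; apply: eq_bigr => l _ /=.
  by rewrite !mxE mulrDl mulrA.
exists (scalar_of vP) => x /=.
rewrite (row_scalar_sum w) (row_linear_sum (sf_tr _)).
under eq_bigr do rewrite summxE mulr_suml.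
rewrite exchange_big; apply: eq_bigr => p _.
have /rowP /(_ p) := tE; rewrite mxE => ->; rewrite summxE mulr_sumr.
by apply: eq_bigr => l _; rewrite !mxE mulrAC -mulrA.
Qed.

Lemma stable_flat_ml : flat_mittag_leffler M.
Proof.
exists sf_idx, sf_le, (fun i => 'rV[R]_(sf_m i.2)), sf_tr, sf_cocone.
split; [exact: sf_dirlim| |exact: sf_dual_ml].
by move=> i; exists (sf_m i.2), idfun; exists idfun.
Qed.
End StableFlatML.

(** * Affine kernels *)

Section SquareZeroMap.
Variables (R : comPzRingType) (N N' : lmodType R) (g : {linear N -> N'}).

Let f (x : sqz (A := calg_base R) N) : sqz (A := calg_base R) N' := (x.1,
  g x.2).

Lemma sqz_mapD : {morph f : x y / x + y}.
Proof. by move=> x y; congr pair; rewrite /= linearD. Qed.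
Lemma sqz_mapM : {morph f : x y / x * y}.
Proof. by move=> x y; congr pair; rewrite /= linearD !linearZ. Qed.
Lemma sqz_map1 : f 1 = 1.
Proof. by congr pair; rewrite /= linear0. Qed.
Lemma sqz_map_str r : f (calg_str _ r) = calg_str _ r.
Proof. by congr pair; rewrite /= linear0. Qed.

Definition sqz_map :
    calg_hom (sqz (A := calg_base R) N) (sqz (A := calg_base R) N') :=
  @CAlgHom R _ _ (rmorphism_of sqz_mapD sqz_map1 sqz_mapM) sqz_map_str.

End SquareZeroMap.

Section AffineKernel.
Variables (R : comPzRingType) (M : lmodType R) (n : nat) (x : 'I_n -> M).
Variables (A : calg R) (kappa : 'I_n -> A).
Hypothesis kappa0 : \sum_k tmul (x k) (kappa k) = 0.
Hypothesis kappa_ex : forall (B : calg R) (b : 'I_n -> B),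
  \sum_k tmul (x k) (b k) = 0 ->
  exists phi : calg_hom A B, forall k, b k = phi (kappa k).
Hypothesis kappa_inj : forall (B : calg R) (phi psi : calg_hom A B),
  (forall k, phi (kappa k) = psi (kappa k)) -> phi =1 psi.

Let comb (c : 'I_n -> R) : A := \sum_k calg_str A (c k) * kappa k.
Let U (a : calg_lmod A) := exists c, a = comb c.

Let combD c c' : comb (fun k => c k + c' k) = comb c + comb c'.
Proof.
rewrite /comb -big_split; apply: eq_bigr => k _.
by rewrite rmorphD mulrDl.
Qed.

Let combZ r c : comb (fun k => r * c k) = calg_str A r * comb c.
Proof.
rewrite /comb mulr_sumr; apply: eq_bigr => k _.
by rewrite rmorphM mulrA.
Qed.

Let comb0 : comb (fun=> 0) = 0.
Proof. by rewrite /comb big1 // => k _; rewrite rmorph0 mul0r. Qed.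

Let subU : submod_prop U.
Proof.
split.
- by exists (fun=> 0); rewrite comb0.
- by move=> a b [c ->] [d ->]; exists (fun k => c k + d k); rewrite combD.
- by move=> r a [c ->]; exists (fun k => r * c k); rewrite combZ.
Qed.

Let delta k : 'I_n -> R := fun l => (l == k)%:R.

Let comb_delta k : comb (delta k) = kappa k.
Proof.
rewrite /comb (bigD1 k) //= /delta eqxx rmorph1 mul1r big1 ?addr0 // => l.
by move=> /negPf ->; rewrite rmorph0 mul0r.
Qed.

(* The solutions of sum_k x_k (x) b_k = 0 are stable under R-linear maps, so
   (0, kappa) is a solution in R (+) A and comes from phi : A -> R (+) A; the
   two maps from R (+) A to R (+) A / U agree on (0, kappa), hence on the image
   of phi. *)
Lemma affine_kernel_proj : exists sigma : {linear calg_lmod A -> calg_lmod A},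
  (forall k, sigma (kappa k) = kappa k) /\ forall a, U (sigma a).
Proof.
pose E := sqz (A := calg_base R) (calg_lmod A : lmodType R).
have inr_lin : linear ((fun a => (0, a)) : calg_lmod A -> calg_lmod E).
  move=> r a b; rewrite calg_lmodZ.
  by congr pair; rewrite /= ?(mulr0, addr0) // scaler0 addr0.
have [|phi phiE] := @kappa_ex E (fun k => (0, kappa k)).
  have := congr1 (tensor_lin M (linear_of inr_lin)) kappa0.
  rewrite raddf0 raddf_sum; apply: etrans; apply: eq_bigr => k _.
  by rewrite tensor_lin_tmul.
have sigma_lin : linear ((fun a => (phi a).2) : calg_lmod A -> calg_lmod A).
  move=> r a b; rewrite calg_lmodZ rmorphD rmorphM calg_homE /=.
  by congr (_ + _); rewrite /= scaler0 addr0.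
exists (linear_of sigma_lin); split=> [k|a]; first by rewrite /= -phiE.
pose p1 := sqz_map (quot_pi subU).
pose p2 := sqz_map (\0 : {linear calg_lmod A -> quot_mod subU}).
apply/(quot_pi0P subU).
have p12 : calg_comp p1 phi =1 calg_comp p2 phi.
  apply: kappa_inj => k; rewrite /= -phiE; congr pair.
  by apply/quot_pi0P; exists (delta k); rewrite comb_delta.
have := p12 a; rewrite /= => /(congr1 snd); exact.
Qed.

(** With $K$ the kernel of [comb] on $R^n$, this is the image of $M\otimes K$ in $M^n$. The quotient
    [V] is thus $M\otimes(R^n/K)=M\otimes U$, where [pure m c] stands for $m\otimes$ [comb c]. *)
Let X (z : {ffun 'I_n -> M}) := exists m (y : 'I_m -> M) (c : 'I_m -> 'I_n ->
  R),
  (forall j, comb (c j) = 0) /\ forall k, z k = \sum_j c j k *: y j.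

Let subX : submod_prop X.
Proof.
split.
- exists 0%N, (fun=> 0), (fun _ _ => 0); split=> [[]//|k].
  by rewrite ffunE big_ord0.
- move=> z z' [m [y [c [c0 zE]]]] [m' [y' [c' [c'0 z'E]]]].
  exists (m + m')%N,
    (fun j => match split j with inl j => y j | inr j => y' j end),
    (fun j => match split j with inl j => c j | inr j => c' j end).
  split=> [j|k]; first by case: split.
  rewrite ffunE zE z'E big_split_ord; congr (_ + _); apply: eq_bigr => j _.
    by rewrite (unsplitK (inl j)).
  by rewrite (unsplitK (inr j)).
- move=> r z [m [y [c [c0 zE]]]]; exists m, (fun j => r *: y j), c.
  split=> // k; rewrite ffunE zE scaler_sumr; apply: eq_bigr => j _.
  by rewrite !scalerA mulrC.
Qed.

Let V : lmodType R := quot_mod subX.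

Let pure (m : M) (c : 'I_n -> R) : V := quot_pi subX [ffun k => c k *: m].

Let pure_eq m c c' : comb c = comb c' -> pure m c = pure m c'.
Proof.
move=> cc'; apply/quot_piP.
exists 1%N, (fun=> m), (fun _ k => c k + (-1) * c' k); split=> [j|k].
  by rewrite combD combZ cc' rmorphN1 mulN1r subrr.
by rewrite !ffunE big_ord1 mulN1r scalerBl.
Qed.

(** Applying $M\otimes\sigma$ to the generic relation gives $\sum_k x_k\otimes\kappa_k=0$ in
    $M\otimes U$, since $\sigma$ fixes $\kappa$. This says that $x=Py$ with $\kappa P=0$, and every
    solution is a specialization of $\kappa$. *)
Lemma affine_kernel_factor : factors_stably x.
Proof.
have [sigma [sigma_k sigmaU]] := affine_kernel_proj.
pose c a := sval (cid (sigmaU a)).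
have cE a : sigma a = comb (c a) := svalP (cid (sigmaU a)).
have @L : {additive tensor M A -> V}.
  refine (@tensor_lift R M A V (fun m a => pure m (c a)) _ _ _).
  - move=> m m' a; rewrite /pure -(linearD (quot_pi subX)); congr (quot_pi _ _).
    by apply/ffunP => k; rewrite !ffunE scalerDr.
  (* The chosen coefficients [c] need not be additive in [a], but [pure] depends on them only
     through [comb], that is, through [sigma]. *)
  - move=> m a a'; rewrite (pure_eq m (c' := fun k => c a k + c a' k)).
      rewrite /pure -(linearD (quot_pi subX)); congr (quot_pi _ _).
      by apply/ffunP => k; rewrite !ffunE scalerDl.
    by rewrite combD -!cE (linearD sigma).
  - move=> r m a; rewrite [RHS](pure_eq m (c' := fun k => r * c a k)).
      congr (quot_pi _ _).
      by apply/ffunP => k; rewrite !ffunE scalerA mulrC.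
    rewrite combZ -!cE; exact: (linearZ_LR sigma).
have : X [ffun k => x k].
  apply/(quot_pi0P subX); have := congr1 L kappa0.
  rewrite raddf0 raddf_sum => Lx; apply: etrans _ Lx.
  transitivity (\sum_k pure (x k) (delta k)).
    rewrite /pure -linear_sum; congr (quot_pi _ _); apply/ffunP => l.
    rewrite sum_ffunE ffunE (bigD1 l) //= ffunE /delta eqxx scale1r big1 ?addr0
      //.
    by move=> k kl; rewrite ffunE eq_sym (negPf kl) scale0r.
  apply: eq_bigr => k _; rewrite [RHS]tensor_lift_tmul; apply: pure_eq.
  by rewrite comb_delta -cE sigma_k.
move=> [m [y [d [d0 xE]]]]; exists m, y, (fun k j => d j k).
split=> [k|B b bx j]; first by rewrite -xE ffunE.
have [phi phiE] := kappa_ex bx.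
have /(congr1 phi) := d0 j; rewrite rmorph0 rmorph_sum; apply: etrans.
by apply: eq_bigr => k _; rewrite phiE rmorphM calg_homE mulrC.
Qed.
End AffineKernel.

(** * The module $\mathcal R^n$ as a dual, and morphisms out of it *)

Section FreeModules.
Variables (R : comPzRingType) (n : nat).

Definition free_of_dual : rmor (dual_qcoh 'rV[R]_n) (free_mod R n).
Proof.
refine (@RMor R (dual_qcoh 'rV[R]_n) (free_mod R n)
  (fun A w => \row_k dev w (delta_mx 0 k)) _ _ _).
- by move=> A B h w; apply/rowP => k; rewrite !mxE dev_map.
- by move=> A w w'; apply/rowP => k; rewrite !mxE devD.
- by move=> A a w; apply/rowP => k; rewrite !mxE devZ.
Defined.

Lemma free_of_dualE (A : calg R) (w : dual_qcoh 'rV[R]_n A) k :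
  (free_of_dual A w : 'rV[A]_n) 0 k = dev w (delta_mx 0 k).
Proof. by rewrite mxE. Qed.

Lemma dev_row (A : calg R) (w : dual_qcoh 'rV[R]_n A) (u : 'rV[R]_n) :
  dev w u = \sum_k calg_str A (u 0 k) * dev w (delta_mx 0 k).
Proof.
rewrite {1}[u]row_sum_delta dev_sumr.
by apply: eq_bigr => k _; rewrite dev_scaler.
Qed.

Lemma free_of_dual_inj (A : calg R) : injective (free_of_dual A).
Proof.
move=> w w' ww'; apply: dev_inj => u; rewrite !dev_row; apply: eq_bigr => k _.
by rewrite -!free_of_dualE ww'.
Qed.

Lemma free_of_dual_surj (A : calg R) (b : 'rV[A]_n) :
  exists w, free_of_dual A w = b.
Proof.
have v_lin : linear ((fun u : 'rV[R]_n => \sum_k calg_str A (u 0 k) * b 0 k)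
    : 'rV[R]_n -> calg_lmod A).
  move=> r u u'; rewrite calg_lmodZ mulr_sumr -big_split; apply: eq_bigr => k _.
  by rewrite !mxE rmorphD rmorphM mulrDl mulrA.
exists (dmk (linear_of v_lin)); apply/rowP => k.
rewrite free_of_dualE dev_dmk /= (bigD1 k) //= mxE !eqxx rmorph1 mul1r.
by rewrite big1 ?addr0 // => l /negPf lk; rewrite mxE lk rmorph0 mul0r.
Qed.

Lemma free_of_dual_riso : is_riso free_of_dual.
Proof.
by apply: bij_riso; [apply: free_of_dual_inj | apply: free_of_dual_surj].
Qed.
End FreeModules.

Section FromFree.
Variables (R : comPzRingType) (M : lmodType R) (n : nat).

Definition free_mor (x : 'I_n -> M) : rmor (free_mod R n) (qcoh M).
Proof.
refine (@RMor R (free_mod R n) (qcoh M)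
  (fun A (b : 'rV[A]_n) => \sum_k tmul (x k) (b 0 k) : tensor M A) _ _ _).
- move=> A B h b; rewrite smap_qcoh_sum; apply: eq_bigr => k _.
  by rewrite smap_tmul mxE.
- move=> A b b'; rewrite /radd /= -big_split; apply: eq_bigr => k _.
  by rewrite mxE tmulDr.
- move=> A a b; apply: etrans (esym (tensor_scale_sum _ _ _)).
  by apply: eq_bigr => k _; rewrite mxE.
Defined.

Lemma free_morE x (A : calg R) (b : 'rV[A]_n) :
  free_mor x A b = \sum_k tmul (x k) (b 0 k) :> tensor M A.
Proof. by []. Qed.

End FromFree.

(** * From kernels and factorizations to stable factorizations *)

Section ToStable.
Variables (R : comPzRingType) (M : lmodType R).

(** By the Yoneda lemma, the point of [K] given by the identity of [A] is universal; its coordinates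
    form the generic solution [kappa]. *)
Lemma affine_solutions_factor n (x : 'I_n -> M) (K : rmodule R)
    (j : rmor K (free_mod R n)) :
  affine_mod K -> rmono j ->
  (forall (B : calg R) (b : 'rV[B]_n),
     \sum_k tmul (x k) (b 0 k) = 0 <-> exists z, j B z = b) ->
  factors_stably x.
Proof.
move=> [A [s [u [v uv]]]] j_inj jK.
pose z : K A := v A (calg_id A).
have vE (B : calg R) (phi : calg_hom A B) : v B phi = smap phi z.
  by rewrite -(rmor_nat v); congr (v B _); apply: calg_hom_inj.
pose kappa k := (j A z : 'rV[A]_n) 0 k.
have jE (B : calg R) (phi : calg_hom A B) k :
    (j B (v B phi) : 'rV[B]_n) 0 k = phi (kappa k).
  by rewrite vE rmor_nat mxE.
apply: (@affine_kernel_factor R M n x A kappa).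
- by apply/jK; exists z.
- move=> B b bx; have [|y yE] := (jK B (\row_k b k)).1.
    by rewrite -[RHS]bx; apply: eq_bigr => k _; rewrite mxE.
  exists (u B y) => k; have [uK _] := uv B.
  by rewrite -jE uK yE mxE.
- move=> B phi psi phipsi; have [_ vK] := uv B.
  suff -> : phi = psi by [].
  apply: (can_inj vK); apply: j_inj; apply/rowP => k.
  by rewrite !jE.
Qed.

Lemma ker_free_stable :
  (forall n (f : rmor (free_mod R n) (qcoh M)),
     reflexive_affine_mod (sub_mod (ker f))) -> stable_factorization M.
Proof.
move=> kerA n x; have [_ Kaff] := kerA n (free_mor x).
apply: (affine_solutions_factor (j := sub_incl (ker (free_mor x))) Kaff).
  by move=> B; apply: sval_inj.
move=> B b; split=> [b0|[[z z0] <-]]; last exact: z0.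
by exists (exist _ b b0).
Qed.

Lemma ker_dual_stable :
  (forall (N : lmodType R) (f : rmor (dual_qcoh N) (qcoh M)),
     reflexive_affine_mod (sub_mod (ker f))) -> stable_factorization M.
Proof.
move=> kerA n x; pose f := rmor_comp (free_mor x) (free_of_dual R n).
have [_ Kaff] := kerA _ f.
apply: (affine_solutions_factor
  (j := rmor_comp (free_of_dual R n) (sub_incl (ker f))) Kaff).
  by move=> B u v /free_of_dual_inj; apply: sval_inj.
move=> B b; split=> [b0|[[z z0] <-]]; last exact: z0.
have [w wb] := free_of_dual_surj b.
have fw : f B w = rzero.
  by rewrite -[LHS]/(free_mor x B (free_of_dual R n B w)) wb.
by exists (exist _ w fw).
Qed.

(** Writing [g] as $\sum_j y_j\otimes w_j$, take $P_{kj}=v_k(w_j)$. If [b] is a solution, then [g]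
    sends $\sum_k b_kv_k$ to $\sum_k x_k\otimes b_k=0$, so this form is zero, and its value at $w_j$
    is the $j$-th equation. *)
Lemma mono_dual_factor n (x : 'I_n -> M) (W : lmodType R)
    (g : rmor (dual_qcoh W) (qcoh M)) (v : 'I_n -> dual_qcoh W (calg_base R)) :
  rmono g -> (forall k, g _ (v k) = tmul (x k) 1) ->
  factors_stably x.
Proof.
move=> g_inj gv; have [m [y [w gE]]] := from_dual_pairing g.
pose P k j : R := dev (v k) (w j).
have xP k : x k = \sum_j P k j *: y j.
  have := gv k; rewrite gE pairingE (tmul_base_sum y (P k)).
  move=> /(congr1 (@tensor_base R M)); rewrite !tensor_base_tmul !scale1r.
  by [].
exists m, y, P; split=> // B b b0 j.
have om_lin : linear ((fun z => \sum_k b k * calg_str B (dev (v k) z))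
    : W -> calg_lmod B).
  move=> r z z'; rewrite calg_lmodZ mulr_sumr -big_split; apply: eq_bigr => k _.
  by rewrite dev_addr dev_scaler rmorphD rmorphM mulrDr mulrCA.
pose om := dmk (linear_of om_lin).
have om0 : om = rzero.
  apply: (g_inj B); rewrite (rmor0 g) gE pairingE -[RHS]b0 (tmul_subst b xP).
  by apply: eq_bigr => i _; rewrite dev_dmk.
by have := dev_dmk (linear_of om_lin) (w j); rewrite -/om om0 dev0.
Qed.

Lemma factor_mono (F : rmodule R) (f : rmor F (qcoh M)) n (x : 'I_n -> M)
    (v : 'I_n -> F (calg_base R)) :
  factors_through_dual_sub f -> (forall k, f _ (v k) = tmul (x k) 1) ->
  factors_stably x.
Proof.
move=> [W [S [_ [i [i' ii']] [g fE]]]] fv.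
apply: (@mono_dual_factor n x W (rmor_comp (sub_incl S) i')
  (fun k => i _ (g _ (v k)))).
  by move=> A u u' /= /sval_inj; have [_ i'K] := ii' A; apply: (can_inj i'K).
by move=> k; have [iK _] := ii' (calg_base R); rewrite /= iK -fv fE.
Qed.

Lemma factor_free_stable :
  (forall n (f : rmor (free_mod R n) (qcoh M)), factors_through_dual_sub f) ->
  stable_factorization M.
Proof.
move=> fact n x; pose v k : free_mod R n (calg_base R) := delta_mx 0 k.
apply: (factor_mono (x := x) (v := v) (fact n (free_mor x))) => k.
 rewrite free_morE (bigD1 k) //= mxE !eqxx big1 ?addr0 // => l /negPf lk.
by rewrite mxE lk tmul0r.
Qed.

Lemma factor_dual_free :
  (forall (N : lmodType R) (f : rmor (dual_qcoh N) (qcoh M)),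
     factors_through_dual_sub f) ->
  forall n (f : rmor (free_mod R n) (qcoh M)), factors_through_dual_sub f.
Proof.
move=> fact n f; have [h hK] := free_of_dual_riso R n.
have [W [S [Saff SW [g fE]]]] := fact _ (rmor_comp f (free_of_dual R n)).
exists W, S; split=> //; exists (rmor_comp g h); apply: rmor_inj => A b.
have [_ hA] := hK A.
have := congr1 (fun u : rmor _ _ => u A (h A b)) fE.
rewrite -[X in X = _]/(f A (free_of_dual R n A (h A b))) hA; exact.
Qed.
End ToStable.

(** * Affine submodules of $\mathcal M$ and direct limits *)

Section SubmoduleTools.
Variables (R : comPzRingType) (M : lmodType R).
Implicit Types S T : submodule (qcoh M).

Lemma sm_sum S (A : calg R) n (t : 'I_n -> tensor M A) :
  (forall k, S A (t k)) -> S A (\sum_k t k : tensor M A).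
Proof.
move=> St; elim/big_ind: _ => [|u v|//]; first exact: sm_zero.
exact: sm_add.
Qed.

Lemma sm_tmul S (m : M) (A : calg R) (a : A) :
  S (calg_base R) (tmul m 1) -> S A (tmul m a).
Proof.
pose h : calg_hom (calg_base R) A :=
  @CAlgHom R (calg_base R) A (calg_str A) (fun=> erefl).
move=> /(sm_map h); rewrite smap_tmul rmorph1 => /(sm_scale a).
by rewrite /rscale /= -tmulZr mulr1.
Qed.

Lemma sm_comb S n (x : 'I_n -> M) (A : calg R) (b : 'I_n -> A) :
  (forall k, S (calg_base R) (tmul (x k) 1)) ->
  S A (\sum_k tmul (x k) (b k) : tensor M A).
Proof. by move=> Sx; apply: sm_sum => k; apply: sm_tmul. Qed.

(** The universal point of [S] over its representing algebra is a finite sum $\sum_k x_k\otimes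
    a_k$, and every point of [S] is an image of it. *)
Lemma affine_sub_gen S : affine_mod (sub_mod S) ->
  exists n (x : 'I_n -> M), forall T,
    (forall k, T (calg_base R) (tmul (x k) 1)) -> sub_le S T.
Proof.
move=> [A [s [u [v uv]]]]; pose z : sub_mod S A := v A (calg_id A).
have [n [x [a zE]]] := tensor_sumP (sval z : tensor M A).
exists n, x => T Tx B t St; have [uK _] := uv B.
have -> : t = smap (u B (exist _ t St)) (sval z).
  transitivity (sval (v B (u B (exist _ t St)))); first by rewrite uK.
  rewrite -[RHS]/(sval (smap (s := sub_mod S) (u B (exist _ t St)) z)).
  by rewrite -(rmor_nat v); congr (sval (v B _)); apply: calg_hom_inj.
by apply: sm_map; rewrite zE; apply: sm_comb.
Qed.

Section AffineFactor.
Variables (n : nat) (x : 'I_n -> M) (S : submodule (qcoh M)).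
Hypothesis Sx : forall k, S (calg_base R) (tmul (x k) 1).

Let pt (B : calg R) (b : 'I_n -> B) : sub_mod S B :=
  exist _ (\sum_k tmul (x k) (b k) : tensor M B) (sm_comb b Sx).

Let pt_map (B C : calg R) (h : calg_hom B C) (b : 'I_n -> B) :
  smap h (pt b) = pt (h \o b).
Proof.
apply: sval_inj; rewrite /= [LHS]smap_qcoh_sum.
by apply: eq_bigr => k _; apply: smap_tmul.
Qed.

(** The solutions are the fibre over zero of the morphism $\mathcal R^n\to S$ given by [x], hence
    are represented by a quotient of a polynomial ring. *)
Lemma affine_sub_factor : affine_mod (sub_mod S) ->
  factors_stably x.
Proof.
move=> [A [s [u [v uv]]]].
(* [T] is the polynomial ring, presented without relations; [phi] is the comorphism of $\mathcal
   R^n\to S$, read at the generic point [X], and [z] is the zero section of [S]. *)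
pose T := pres_alg (fun _ _ : alg_term R 'I_n => False).
pose X k : T := pres_var _ k.
pose phi : calg_hom A T := u T (pt X).
pose z : calg_hom A (calg_base R) := u (calg_base R) rzero.
(* The equations in b expressing that the morphism from R^n to S = Spec A
   given by x sends b to 0. *)
pose rel (s t : alg_term R 'I_n) :=
  exists a : A, s = repr (phi a) /\ t = AConst (z a).
have zeroP (B : calg R) (b : 'I_n -> B) : \sum_k tmul (x k) (b k) = 0 <->
    forall s t, rel s t -> alg_eval b s = alg_eval b t.
  pose h : calg_hom (calg_base R) B :=
    @CAlgHom R (calg_base R) B (calg_str B) (fun=> erefl).
  pose ev : calg_hom T B := pres_hom (rel := fun _ _ => False) (v := b)
    (fun _ _ (f : False) => match f with end).
  have evX : ev \o X =1 b by move=> k; apply: pres_homE.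
  have ubE : u B (pt b) = calg_comp ev phi.
    rewrite -[RHS]/(smap (s := spec_fun A) ev phi) -(rmor_nat u) pt_map.
    by congr (u B (pt _)); apply: funext => k; rewrite evX.
  have u0E : u B rzero = calg_comp h z.
    by rewrite -[RHS]/(smap (s := spec_fun A) h z) -(rmor_nat u) rmap0.
  have evE a : ev (phi a) = alg_eval b (repr (phi a)).
    transitivity (ev (pres_pi (fun _ _ : alg_term R 'I_n => False) (repr (phi
      a)))).
      by rewrite /pres_pi reprK.
    exact: pres_hom_funE.
  split=> [b0 _ _ [a [-> ->]]|ab].
    have pt0 : pt b = rzero by apply: sval_inj.
    rewrite -evE; exact: (congr1 (fun f : calg_hom A B => f a)
      (etrans (esym ubE) (etrans (congr1 (u B) pt0) u0E))).
  suff : pt b = rzero by move=> /(congr1 sval).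
  have [uK _] := uv B; apply: (can_inj uK); rewrite ubE u0E.
  apply: calg_hom_inj => a; apply: (etrans (evE a)).
  by apply: (ab _ (AConst (z a))); exists a.
apply: (@affine_kernel_factor R M n x (pres_alg rel) (pres_var rel)).
- by apply/zeroP; apply: pres_var_rel.
- by move=> B b /zeroP bP; exists (pres_hom bP) => k; rewrite pres_homE.
- by move=> B f f' ff' a; rewrite (pres_hom_inj ff').
Qed.
End AffineFactor.

Lemma dirlim_submodules_common P n (x : 'I_n -> M) :
  dirlim_of_submodules (qcoh M) P ->
  exists S, P (sub_mod S) /\ forall k, S (calg_base R) (tmul (x k) 1).
Proof.
move=> [[dir _ _] lim].
elim: n x => [|n IHn] x.
  have [[S PS]] := dir_inhabited dir; exists S; split=> // k.
  by case: k.
have [S [PS Sx]] := IHn (fun k => x (lift ord0 k)).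
have [[T PT] [[y Ty] yE]] := lc_surj (lim (calg_base R)) (tmul (x ord0) 1).
have [[V PV] /= [SV TV]] := dir_ub dir (exist _ S PS) (exist _ T PT).
exists V; split=> // k; case: (unliftP ord0 k) => [l ->|->].
  exact: SV (Sx l).
by apply: TV; rewrite -yE.
Qed.

Lemma dirlim_affine_stable P :
  (forall F, P F -> affine_mod F) ->
  dirlim_of_submodules (qcoh M) P -> stable_factorization M.
Proof.
move=> Paff lim n x; have [S [PS Sx]] := dirlim_submodules_common x lim.
exact: affine_sub_factor Sx (Paff _ PS).
Qed.

(** Points with the same image in the limit agree at a later index, so injective transition maps
    make the maps to the limit injective; then [mono_dual_factor] applies at an index that reaches
    all of [x]. *)
Lemma dirlim_dual_stable :
  dirlim_of_dual_monos (qcoh M) -> stable_factorization M.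
Proof.
move=> [I [le [N [tr [phi [[[dir _ _] lim] tr_mono]]]]]] n x.
have phi_mono i : rmono (phi i).
  move=> A w w' /(lc_inj (lim A)) [k [ik [ik']]].
  by rewrite (Prop_irrelevance ik ik'); apply: tr_mono.
have [i [v vE]] : exists i (v : 'I_n -> dual_qcoh (N i) (calg_base R)),
    forall k, phi i _ (v k) = tmul (x k) 1.
  elim: n x => [|n IHn] x.
    have [i] := dir_inhabited dir.
    by exists i, (fun=> rzero) => -[].
  have [i [v vE]] := IHn (fun k => x (lift ord0 k)).
  have [j [w wE]] := lc_surj (lim (calg_base R)) (tmul (x ord0) 1).
  have [l [il jl]] := dir_ub dir i j.
  exists l, (fun k => if unlift ord0 k is Some k' then tr i l il _ (v k')
                      else tr j l jl _ w).
  by move=> k; case: unliftP => [k' ->|->];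
    rewrite (lc_compat (lim (calg_base R))).
exact: mono_dual_factor (phi_mono i) vE.
Qed.
End SubmoduleTools.

(** * Submodules and kernels of the form W^* *)

Section Images.
Variables (R : comPzRingType) (F G : rmodule R) (f : rmor F G).

Definition rimage : submodule G.
Proof.
refine (@Submodule R G (fun A y => exists x, f A x = y) _ _ _ _).
- by move=> A; exists rzero; rewrite rmor0.
- by move=> A _ _ [x <-] [y <-]; exists (radd x y); rewrite rmorD.
- by move=> A a _ [x <-]; exists (rscale a x); rewrite rmorZ.
- by move=> A B h _ [x <-]; exists (smap h x); rewrite rmor_nat.
Defined.

Section Corestrict.
Variables (S : submodule G) (fS : forall A x, S A (f A x)).

Definition corestrict : rmor F (sub_mod S).
Proof.
refine (@RMor R F (sub_mod S) (fun A x => exist _ (f A x) (fS x)) _ _ _).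
- by move=> A B h x; apply: sval_inj; apply: (rmor_nat f).
- by move=> A x y; apply: sval_inj; apply: (rmorD f).
- by move=> A a x; apply: sval_inj; apply: (rmorZ f).
Defined.

Lemma corestrict_riso :
  rmono f -> (forall A y, S A y -> exists x, f A x = y) ->
  risomorphic F (sub_mod S).
Proof.
move=> f_inj f_surj; exists corestrict; apply: bij_riso => A.
  by move=> x y /(congr1 sval); apply: f_inj.
by move=> [y Sy]; have [x xy] := f_surj A y Sy; exists x; apply: sval_inj.
Qed.
End Corestrict.

Lemma rimage_riso : rmono f -> risomorphic (sub_mod rimage) F.
Proof.
have fS A x : rimage A (f A x) by exists x.
by move=> f_inj; apply: riso_sym; apply: (corestrict_riso fS).
Qed.
End Images.

Definition is_dual_qcoh (R : comPzRingType) (F : rmodule R) : Prop :=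
  exists W : lmodType R, risomorphic F (dual_qcoh W).

Lemma is_dual_qcoh_reflexive_affine (R : comPzRingType) (F : rmodule R) :
  is_dual_qcoh F -> reflexive_affine_mod F.
Proof. by move=> [W FW]; apply: dual_qcoh_reflexive_affine FW. Qed.

(** * From stable factorizations to the remaining conditions *)

Section FromStable.
Variables (R : comPzRingType) (M : lmodType R).
Hypothesis stable : stable_factorization M.

(* With x = P y and y = P' y' stable factorizations, W = R^m / ker P. If
   v : W -> A satisfies sum_j y_j (x) v_j = 0, then v P' = 0. The relations of
   x are those of P and also those of P P', so the columns of P are
   combinations P P' T of those of P P', and v = v P' T = 0. *)
Lemma stable_sub n (x : 'I_n -> M) : exists S : submodule (qcoh M),
  is_dual_qcoh (sub_mod S) /\ forall k, S (calg_base R) (tmul (x k) 1).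
Proof.
have [m [y [P [xP Pker]]]] := stable x.
have [m' [y' [P' [yP' P'ker]]]] := stable y.
pose K (z : 'rV[R]_m) := forall k, \sum_j P k j * z 0 j = 0.
have subK : submod_prop K.
  split.
  - by move=> k; rewrite big1 // => j _; rewrite mxE mulr0.
  - move=> z z' zK z'K k; under eq_bigr do rewrite mxE mulrDr.
    by rewrite big_split /= zK z'K addr0.
  - move=> r z zK k; under eq_bigr do rewrite mxE mulrCA.
    by rewrite -mulr_sumr zK mulr0.
pose W : lmodType R := quot_mod subK.
pose w j : W := quot_pi subK (delta_mx 0 j).
have wE (z : 'rV[R]_m) : quot_pi subK z = \sum_j z 0 j *: w j.
  by rewrite row_linear_sum.
pose PP k l := \sum_j P k j * P' j l.
have [T TE] : exists T : 'I_m -> 'I_m' -> R,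
    forall j k, P k j = \sum_l T j l * PP k l.
  have rel j : exists t : 'I_m' -> R,
      \row_k P k j = \sum_l t l *: (\row_k PP k l).
    apply: relations_span => A a aPP; under eq_bigr do rewrite mxE.
    (* A relation of $PP'$ is a relation of $x=PP'y'$, and therefore of $P$. *)
    apply: Pker; rewrite (tmul_subst a xP).
    rewrite (tmul_subst (fun j => \sum_k a k * calg_str A (P k j)) yP') big1 //
      => l _.
    rewrite (_ : \sum_j _ = 0) ?tmul0r //; apply: etrans (aPP l).
    under eq_bigr do rewrite mulr_suml.
    rewrite exchange_big; apply: eq_bigr => k _;
      rewrite mxE rmorph_sum mulr_sumr.
    by apply: eq_bigr => j' _; rewrite rmorphM mulrA.
  exists (fun j => sval (cid (rel j))) => j k.
  have /rowP /(_ k) := svalP (cid (rel j)); rewrite mxE summxE => ->.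
  by apply: eq_bigr => l _; rewrite !mxE.
(* Since $P=PP'T$, the $j$-th unit vector and the $j$-th column of $P'T$ have the same class modulo
   the kernel of $P$. *)
have wT j : w j = \sum_i (\sum_l T j l * P' i l) *: w i.
  transitivity (quot_pi subK (\row_i \sum_l T j l * P' i l)).
    apply/quot_piP => k; under eq_bigr do rewrite !mxE mulrBr.
    rewrite sumrB (bigD1 j) //= !eqxx mulr1 big1 ?addr0; last first.
      by move=> i /negPf ij; rewrite ij mulr0.
    rewrite TE; apply/eqP; rewrite subr_eq0; apply/eqP.
    under [RHS]eq_bigr do rewrite mulr_sumr.
    rewrite exchange_big; apply: eq_bigr => l _; rewrite mulr_sumr.
    by apply: eq_bigr => i _; rewrite mulrCA.
  by rewrite wE; apply: eq_bigr => i _; rewrite mxE.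
have g_inj : rmono (pairing y w).
  move=> A om om'; rewrite !pairingE => omE; apply: dev_inj.
  pose v j : A := dev om (w j) - dev om' (w j).
  have v0 : \sum_j tmul (y j) (v j) = 0.
    apply: (addIr (\sum_j tmul (y j) (dev om' (w j)))).
    rewrite add0r -[RHS]omE -big_split; apply: eq_bigr => j _.
    by rewrite /= -tmulDr subrK.
  have vP' := P'ker A v v0.
  have ww j : dev om (w j) = dev om' (w j).
    apply/eqP; rewrite -subr_eq0; apply/eqP.
    rewrite [in LHS]wT !dev_sumr -sumrB.
    under eq_bigr do rewrite !dev_scaler -mulrBr rmorph_sum mulr_suml.
    rewrite exchange_big big1 // => l _.
    apply: (etrans _ (mulr0 (calg_str A (T j l)))).
    apply: (etrans _ (congr1 _ (vP' l))); rewrite mulr_sumr.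
    by apply: eq_bigr => i _; rewrite rmorphM -mulrA [calg_str A (P' i l) *
      _]mulrC.
  elim/quot_ind => z; rewrite wE !dev_sumr; apply: eq_bigr => j _.
  by rewrite !dev_scaler ww.
exists (rimage (pairing y w)); split=> [|k]; first by exists W;
  apply: rimage_riso.
(* The preimage of $x_k$ is the form $z\mapsto(Pz)_k$, which vanishes on the kernel of $P$ and so
   descends to [W]. *)
have vk_lin : linear ((fun z : 'rV[R]_m => \sum_j P k j * z 0 j)
    : 'rV[R]_m -> calg_lmod (calg_base R)).
  move=> r z z'; rewrite calg_lmodZ mulr_sumr -big_split; apply: eq_bigr => j _.
  by rewrite !mxE mulrDr mulrCA.
have vk0 z : K z -> linear_of vk_lin z = 0 by apply.
exists (dmk (quot_lift subK vk0)); rewrite pairingE xP tmul_suml.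
apply: eq_bigr => j _; rewrite tmulZ mulr1 dev_dmk quot_liftE /=.
congr tmul; rewrite (bigD1 j) //= mxE !eqxx mulr1 big1 ?addr0 //.
by move=> i /negPf ij; rewrite mxE ij mulr0.
Qed.

(** By [affine_sub_gen], two members have finitely many generators, which lie in a common submodule
    from [stable_sub]; so does any given tensor. Leaving [Q] free treats affine submodules,
    reflexive affine ones and those of the form $W^*$ together. *)
Lemma stable_dirlim (Q : rmodule R -> Prop) :
  (forall F, is_dual_qcoh F -> Q F) -> (forall F, Q F -> affine_mod F) ->
  dirlim_of_submodules (qcoh M) Q.
Proof.
move=> dualQ Qaff.
pose I := {S : submodule (qcoh M) | Q (sub_mod S)}.
have sub n (x : 'I_n -> M) : exists S : I,
    forall k, sval S (calg_base R) (tmul (x k) 1).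
  by have [S [/dualQ QS Sx]] := stable_sub x; exists (exist _ S QS).
have ub (S T : I) : exists V : I,
  sub_le (sval S) (sval V) /\ sub_le (sval T) (sval V).
  have [n [x xS]] := affine_sub_gen (Qaff _ (svalP S)).
  have [m [y yT]] := affine_sub_gen (Qaff _ (svalP T)).
  have [V Vxy] := sub _ (fun k : 'I_(n + m) =>
    match split k with inl k => x k | inr k => y k end).
  exists V; split; [apply: xS => k | apply: yT => k].
    by have := Vxy (unsplit (inl k)); rewrite unsplitK.
  by have := Vxy (unsplit (inr k)); rewrite unsplitK.
split.
  split=> [|S SS A z|S T V ST TV SV A z]; last 2 first.
  - exact: sval_inj.
  - exact: sval_inj.
  split=> [|S A z //|S T V ST TV A z Sz|//].
    by have [S _] := sub 0%N (fun=> 0); exists.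
  exact/TV/ST.
move=> A; split=> // [z|S T u v uv].
  have [n [x [a zE]]] := tensor_sumP (z : tensor M A).
  have [S Sx] := sub n x.
  have Sz : sval S A z by rewrite zE; apply: sm_comb.
  by exists S, (exist _ z Sz).
have [V [SV TV]] := ub S T; exists V, SV, TV.
exact: sval_inj.
Qed.

(** The inclusions among submodules of the form $W^*$ are conjugated by chosen isomorphisms with the
    duals. *)
Lemma stable_dirlim_dual : dirlim_of_dual_monos (qcoh M).
Proof.
have [|[dir tid tcomp] lim] := stable_dirlim (fun F (FW : is_dual_qcoh F) =>
  FW).
  by move=> F /is_dual_qcoh_reflexive_affine [].
pose I := {S : submodule (qcoh M) | is_dual_qcoh (sub_mod S)}.
pose N (S : I) := sval (cid (svalP S)).
pose i (S : I) := sval (cid (svalP (cid (svalP S)))).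
have iP (S : I) : is_riso (i S) := svalP (cid (svalP (cid (svalP S)))).
pose i' S := sval (cid (iP S)).
have ii' S A : cancel (i S A) (i' S A) /\ cancel (i' S A) (i S A) := svalP (cid
  (iP S)) A.
exists I, (fun S T => sub_le (sval S) (sval T)), N,
  (fun S T ST => rmor_comp (i T) (rmor_comp (sub_le_mor ST) (i' S))),
  (fun S => rmor_comp (sub_incl (sval S)) (i' S)).
split; last first.
  move=> S T ST A u u' /= /(can_inj (ii' T A).1) /(congr1 sval) /= /sval_inj.
  exact: (can_inj (ii' S A).2).
split.
  split=> // [S SS A u|S T V ST TV SV A u] /=.
    rewrite [X in i S A X](_ : _ = i' S A u); last exact: sval_inj.
    exact: (ii' S A).2.
  by congr (i V A _); apply: sval_inj; rewrite /= (ii' T A).1.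
move=> A; split=> [S T ST u|z|S T u v /= uv].
- by rewrite /= (ii' T A).1.
- have [S [y yE]] := lc_surj (lim A) z; exists S, (i S A y).
  by rewrite /= (ii' S A).1.
have [V [SV [TV uvV]]] := lc_inj (lim A) uv.
exists V, SV, TV; exact: (congr1 (i V A) uvV).
Qed.

Lemma stable_factor_dual (N : lmodType R) (f : rmor (dual_qcoh N) (qcoh M)) :
  factors_through_dual_sub f.
Proof.
have [n [x [y ->]]] := from_dual_pairing f.
have [S [[W SW] Sx]] := stable_sub x.
exists W, S; split=> //; first exact: riso_affine SW (@dual_qcoh_affine _ _).
exists (corestrict (f := pairing x y) (fun A w => sm_comb _ Sx)).
exact: rmor_inj.
Qed.

(** For $f=\sum_k x_k\otimes y_k$ and $x=Pt$, the kernel consists of the forms that vanish at every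
    $z_j=\sum_k P_{kj}y_k$; it is the dual of $N$ modulo their span [Z]. *)
Lemma stable_ker_dual (N : lmodType R) (f : rmor (dual_qcoh N) (qcoh M)) :
  is_dual_qcoh (sub_mod (ker f)).
Proof.
have [n [x [y ->]]] := from_dual_pairing f.
have [m [t [P [xP Pker]]]] := stable x.
pose z j := \sum_k P k j *: y k.
pose Z (u : N) := exists c : 'I_m -> R, u = \sum_j c j *: z j.
have subZ : submod_prop Z.
  split.
  - by exists (fun=> 0); rewrite big1 // => j _; rewrite scale0r.
  - move=> u u' [c ->] [c' ->]; exists (fun j => c j + c' j).
    by rewrite -big_split; apply: eq_bigr => j _; rewrite scalerDl.
  - move=> r u [c ->]; exists (fun j => r * c j).
    by rewrite scaler_sumr; apply: eq_bigr => j _; rewrite scalerA.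
have zZ j : Z (z j).
  exists (fun i => (i == j)%:R); rewrite (bigD1 j) //= eqxx scale1r.
  by rewrite big1 ?addr0 // => i /negPf ->; rewrite scale0r.
have devz (A : calg R) (w : dual_qcoh N A) j :
    dev w (z j) = \sum_k dev w (y k) * calg_str A (P k j).
  by rewrite dev_sumr; apply: eq_bigr => k _; rewrite dev_scaler mulrC.
have kerP (A : calg R) (w : dual_qcoh N A) :
    pairing x y A w = rzero <-> forall u, Z u -> dev w u = 0.
  rewrite pairingE; split=> [/Pker w0 _ [c ->]|w0].
    by rewrite dev_sumr big1 // => j _; rewrite dev_scaler devz w0 mulr0.
  rewrite (tmul_subst _ xP) big1 // => j _.
  by rewrite -devz w0 ?tmul0r.
pose p := pull (quot_pi subZ).
have pE (A : calg R) w : ker (pairing x y) A (p A w).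
  by apply/kerP => u /(quot_pi0P subZ) u0;
    rewrite dev_pull (congr1 (dev w) u0) dev_0r.
exists (quot_mod subZ); apply: riso_sym; apply: (corestrict_riso pE).
  move=> A w w' ww'; apply: dev_inj; elim/quot_ind => u.
  by rewrite -!dev_pull -/p ww'.
move=> A w /kerP w0; exists (dmk (quot_lift subZ (f := dev_lin w) w0)).
by apply: dev_inj => u; rewrite dev_pull dev_dmk quot_liftE.
Qed.

Lemma stable_ker_free n (f : rmor (free_mod R n) (qcoh M)) :
  is_dual_qcoh (sub_mod (ker f)).
Proof.
pose h := free_of_dual R n.
have [W KW] := stable_ker_dual (rmor_comp f h); exists W.
apply: riso_trans KW; apply: riso_sym.
pose g := rmor_comp h (sub_incl (ker (rmor_comp f h))).
apply: (corestrict_riso (f := g) (S := ker f)).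
- by move=> A [w w0].
- by move=> A u u' /free_of_dual_inj; apply: sval_inj.
- move=> A b b0; have [w wb] := free_of_dual_surj b.
  have w0 : ker (rmor_comp f h) A w by rewrite -wb in b0.
  by exists (exist _ w w0).
Qed.
End FromStable.

(** Condition (3) occurs in both of its forms, as the third and fourth entries. Every implication
    passes through [stable_factorization], except the one from (6) to (7), where $\mathcal R^n$ is
    replaced by an isomorphic dual. *)
Theorem theorem0p3 (R : comPzRingType) (M : lmodType R) :
  [<-> flat_mittag_leffler M;
       dirlim_of_submodules (qcoh M) (@affine_mod R);
       dirlim_of_dual_monos (qcoh M);
       dirlim_of_submodules (qcoh M) (@reflexive_affine_mod R);
       forall (N : lmodType R) (f : rmor (dual_qcoh N) (qcoh M)),
         reflexive_affine_mod (sub_mod (ker f));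
       forall (n : nat) (f : rmor (free_mod R n) (qcoh M)),
         reflexive_affine_mod (sub_mod (ker f));
       forall (N : lmodType R) (f : rmor (dual_qcoh N) (qcoh M)),
         factors_through_dual_sub f;
       forall (n : nat) (f : rmor (free_mod R n) (qcoh M)),
         factors_through_dual_sub f].
Proof.
have refl_aff F : reflexive_affine_mod F -> @affine_mod R F by case.
tfae.
- move=> /flat_ml_stable st; apply: (stable_dirlim st) => //.
  by move=> F /is_dual_qcoh_reflexive_affine [].
- move=> /(dirlim_affine_stable (fun F => id)); exact: stable_dirlim_dual.
- move=> /dirlim_dual_stable st; apply: (stable_dirlim st) refl_aff.
  exact: is_dual_qcoh_reflexive_affine.
- move=> /(dirlim_affine_stable refl_aff) st N f.
  exact/is_dual_qcoh_reflexive_affine/stable_ker_dual.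
- move=> /ker_dual_stable st n f.
  exact/is_dual_qcoh_reflexive_affine/stable_ker_free.
- move=> /ker_free_stable; exact: stable_factor_dual.
- exact: factor_dual_free.
- move=> /factor_free_stable; exact: stable_flat_ml.
Qed.
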